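(* There exists an absolute constant $C>0$ such that for every function $u:\mathbb{N}\to(0,\infty)$ with $u(n)\to\infty$ as $n\to\infty$, $$\inf_{\mu}\Big(\inf\big\{\mathbb{E}_{\mu^N}[\mu(K_N)] : N\geq \exp\big(C(n\ln n)^2u(n)\big)\big\}\Big)\longrightarrow 1\quad\text{as } n\to\infty,$$ where the outer infimum is over all log-concave probability measures $\mu$ on $\mathbb{R}^n$ and $K_N=\mathrm{conv}\{X_1,\ldots,X_N\}$ with $X_1,X_2,\ldots$ independent random points distributed according to $\mu$.
   Context: A log-concave probability measure on $\mathbb{R}^n$ is a Borel probability measure with $\mu(\lambda A+(1-\lambda)B)\geq\mu(A)^\lambda\mu(B)^{1-\lambda}$ for all compact $A,B$ and $\lambda\in(0,1)$, and $\mu(H)<1$ for every hyperplane $H$. *)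

(* Defs.v *)
From HB Require Import structures.
From mathcomp Require Import all_boot all_order all_algebra.
From mathcomp Require Import all_classical all_reals all_analysis.
Set Implicit Arguments. Unset Strict Implicit. Unset Printing Implicit Defensive.
Import Order.TTheory GRing.Theory Num.Theory.
Import numFieldNormedType.Exports.
Local Open Scope classical_set_scope.
Local Open Scope ring_scope.

Definition Rn (R : realType) (n : nat) :=
  g_sigma_algebraType (@open 'rV[R]_n).

Definition mink_comb (R : realType) (n : nat) (l : R) (A B : set 'rV[R]_n)
  : set 'rV[R]_n :=
  [set l *: a + (1 - l) *: b | a in A & b in B].

Definition hyperplane (R : realType) (n : nat) (H : set 'rV[R]_n) : Prop :=
  exists (a : 'rV[R]_n) (b : R), a != 0 /\
    H = [set x | \sum_(i < n) a ord0 i * x ord0 i = b].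

Definition log_concave (R : realType) (n : nat)
  (mu : probability (Rn R n) R) : Prop :=
  (forall (A B : set 'rV[R]_n) (l : R), compact A -> compact B ->
     0 < l < 1 ->
     (fine (mu A) `^ l * fine (mu B) `^ (1 - l) <=
        fine (mu (mink_comb l A B)))%R)
  /\ (forall H : set 'rV[R]_n, hyperplane H -> (mu H < 1)%E).

Definition hullN (R : realType) (n N : nat) (x : nat -> 'rV[R]_n)
  : set 'rV[R]_n :=
  [set y | exists w : nat -> R, (forall i, 0 <= w i) /\
     \sum_(i < N) w i = 1 /\ y = \sum_(i < N) w i *: x i].

Definition scons (T : Type) (t : T) (x : nat -> T) : nat -> T :=
  fun i => if i is j.+1 then x j else t.

(* E_{mu^N}[f(X_0,...,X_{N-1})] for a nonnegative f depending only on the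
   first N coordinates, as an iterated (Tonelli) integral. *)
Fixpoint iter_expect (R : realType) (n : nat) (mu : probability (Rn R n) R)
  (N : nat) (f : (nat -> 'rV[R]_n) -> \bar R) : \bar R :=
  match N with
  | 0 => f (fun _ => 0)
  | k.+1 => (\int[mu]_(t in setT)
              iter_expect mu k (fun x => f (scons (t : 'rV[R]_n) x)))%E
  end.

Definition expected_hull_mass (R : realType) (n : nat)
  (mu : probability (Rn R n) R) (N : nat) : \bar R :=
  iter_expect mu N (fun x => mu (hullN N x)).

Definition inf_quantity (R : realType) (C : R) (u : nat -> R) (n : nat)
  : \bar R :=
  ereal_inf [set ereal_inf [set expected_hull_mass mu N | N in
                 [set N : nat | expR (C * (n%:R * ln n%:R) ^+ 2 * u n) <= N%:R]]
            | mu in [set mu : probability (Rn R n) R | log_concave mu]].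

(* Main.v *)
(** A log-concave measure is put in a position where all its marginals have comparable
    spread: among the directions [a] such that some slab [|<a, x> - b| <= 1] has mass at
    least [1 - 1/n^2], pick a basis of nearly maximal determinant and use it as coordinates.
    By Borell's lemma a cube of side 8 then carries mass [1 - O(n^-3)], whereas every slab of
    half-width 1/3 misses mass [n^-2]. Cut the cube into cells of side [8 n^-9] and call a
    cell heavy when its mass is at least [n^-(9n+3)]; the light cells are negligible, so the
    heavy cells are not contained in a thin slab and contain the vertices of a fat simplex.
    By log-concavity the cell around the centroid of that simplex is heavy as well.
    If [N >= n^(18n+4)], all the heavy cells are hit by the sample with probability
    [1 - 1/n]; the hull then contains a neighbourhood of the centroid cell, hence also
    [(1 - e) G + e Q], where [G] is the union of the heavy cells, [Q] the centroid cell and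
    [e = n^-3]. Log-concavity bounds the mass of this set below by
    [mu(G)^(1-e) mu(Q)^e = 1 - O(1/n)].
    Since the infimum over an empty family is [+oo], the upper bound 1 also needs one
    log-concave measure in every dimension: the uniform measure on the cube, by the
    Prekopa-Leindler inequality and induction on the dimension. *)
Require Import Defs.
From HB Require Import structures.
From mathcomp Require Import all_boot all_order all_algebra.
From mathcomp Require Import all_classical all_reals all_analysis.
From mathcomp Require Import measurable_realfun ring lra.
Set Implicit Arguments. Unset Strict Implicit. Unset Printing Implicit Defensive.
Import Order.TTheory GRing.Theory Num.Theory.
Import numFieldNormedType.Exports.
Local Open Scope classical_set_scope.
Local Open Scope ring_scope.

(** * Iterated expectations and convex hulls *)

Section iterated_expectation.
Context {R : realType} {n : nat} (mu : probability (Rn R n) R).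
Local Open Scope ereal_scope.

(** The integral of a nonnegative function is a supremum over the simple functions below it, so it
    is monotone for arbitrary functions. This lets iterated expectations be compared without a
    measurability proof for their integrands. *)
Lemma le_integral_nonneg (f g : Rn R n -> \bar R) :
  (forall x, 0 <= f x) -> (forall x, f x <= g x) ->
  \int[mu]_x f x <= \int[mu]_x g x.
Proof.
move=> f0 fg; have g0 x : 0 <= g x by exact: le_trans (f0 x) (fg x).
rewrite !ge0_integralTE//; apply: le_ereal_sup => _ [h hf <-].
by exists h => // x; exact: le_trans (hf x) (fg x).
Qed.

Lemma iter_expect_ge0 (N : nat) (f : (nat -> 'rV[R]_n) -> \bar R) :
  (forall x, 0 <= f x) -> 0 <= iter_expect mu N f.
Proof.
elim: N f => [|N IH] f f0 //=.
by apply: integral_ge0 => t _; apply: IH => x.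
Qed.

Lemma le_iter_expect (N : nat) (f g : (nat -> 'rV[R]_n) -> \bar R) :
  (forall x, 0 <= f x) -> (forall x, f x <= g x) ->
  iter_expect mu N f <= iter_expect mu N g.
Proof.
elim: N f g => [|N IH] f g f0 fg //=.
apply: le_integral_nonneg => t; first exact: iter_expect_ge0.
exact: IH.
Qed.

Lemma iter_expect_le1 (N : nat) (f : (nat -> 'rV[R]_n) -> \bar R) :
  (forall x, 0 <= f x) -> (forall x, f x <= 1) -> iter_expect mu N f <= 1.
Proof.
elim: N f => [|N IH] f f0 f1 //=.
apply: (@le_trans _ _ (\int[mu]_x (cst 1 x))).
  by apply: le_integral_nonneg => t; [exact: iter_expect_ge0|exact: IH].
by rewrite integral_cst//= mul1e probability_setT.
Qed.

Context {I : finType} (c : I -> set 'rV[R]_n).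
Hypothesis mc : forall i, measurable (c i : set (Rn R n)).

Definition hit_all (N : nat) (A : {set I}) (x : nat -> 'rV[R]_n) : Prop :=
  forall i, i \in A -> exists2 k, (k < N)%N & c i (x k).

(** A union bound: a cell of mass [m] is missed by [N] independent points with probability
    [(1 - m) ^ N]. The induction on [N] lets [A] vary, since the first point leaves only the cells
    not containing it to the others. *)
Lemma iter_expect_hit_all (N : nat) (A : {set I}) (k : R) : (0 <= k)%R ->
  (k * (1 - \sum_(i in A) (1 - fine (mu (c i))) ^+ N))%:E <=
  iter_expect mu N (fun x => if `[< hit_all N A x >] then k%:E else 0).
Proof.
move=> k0; elim: N A => [|N IH] A /=.
  case: asboolP => [h|h].
    rewrite lee_fin ler_piMr// lerBlDr lerDl.
    by apply: sumr_ge0 => i _; rewrite expr0.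
  have [A0|[i iA]] := set_0Vmem A.
    by exfalso; apply: h => i; rewrite A0 inE.
  rewrite lee_fin mulr_ge0_le0// subr_le0 (bigD1 i)//= expr0 lerDl.
  by apply: sumr_ge0 => j _; rewrite expr0.
pose a i := (1 - fine (mu (c i)))%R.
have a0 i : (0 <= a i)%R.
  rewrite subr_ge0 -lee_fin fineK ?fin_num_measure//; exact: probability_le1.
have aE i : (a i)%:E = mu (~` (c i)).
  by rewrite probability_setC// EFinB fineK ?fin_num_measure.
pose b (i : I) (t : Rn R n) : \bar R := (k * a i ^+ N * \1_(~` c i) t)%:E.
have mb i : measurable_fun setT (b i).
  by apply/measurable_EFinP; apply: measurable_funM => //; apply/measurable_indicP;
    exact: measurableC.
have b0 i t : 0 <= b i t by rewrite lee_fin !mulr_ge0 ?exprn_ge0.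
have ms : measurable_fun setT (fun t => \sum_(i in A) b i t).
  under eq_fun do rewrite -big_enum/=; exact: emeasurable_sum.
have ib i : \int[mu]_t b i t = (k * a i ^+ N * a i)%:E.
  rewrite [RHS]EFinM aE -[~` c i in RHS]setIT -integral_indic//=; last exact: measurableC.
  rewrite -ge0_integralZl//.
  - by apply/measurable_EFinP/measurable_indicP; exact: measurableC.
  - by rewrite lee_fin mulr_ge0 ?exprn_ge0.
(* A measurable minorant of the inner expectation; the truncation at 0 keeps it nonnegative. *)
pose h (t : Rn R n) : \bar R := maxe 0 (k%:E - \sum_(i in A) b i t).
have mh : measurable_fun setT h.
  apply: measurable_maxe => //; exact: emeasurable_funB.
apply: (@le_trans _ _ (\int[mu]_t h t)); last first.
  apply: le_integral_nonneg => t; first by rewrite le_max lexx.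
  rewrite ge_max; apply/andP; split.
    by apply: iter_expect_ge0 => x; case: ifP.
  (* The cells still to be hit once the first point is [t]. *)
  pose A' := [set i in A | `[< (~` c i) t >]]%SET.
  apply: (@le_trans _ _ (iter_expect mu N (fun x => if `[< hit_all N A' x >]
    then k%:E else 0))); last first.
    apply: le_iter_expect => x; first by case: ifP.
    case: asboolP => [hA'|_]; last by case: ifP.
    rewrite ifT//; apply/asboolP => i iA.
    have [cit|ncit] := pselect (c i t); first by exists 0%N.
    by case: (hA' i); [rewrite inE iA; exact/asboolP|move=> j jN ?; exists j.+1].
  apply: le_trans (IH A'); rewrite sumEFin -EFinB lee_fin.
  rewrite mulrBr mulr1 lerD2l lerN2 mulr_sumr [leLHS](_ : _ = \sum_(i in A') k * a i ^+ N)%R//.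
  rewrite [leLHS](eq_bigl (fun i => (i \in A) && `[< (~` c i) t >])); last by move=> i;
    rewrite inE.
  rewrite big_mkcondr/=; apply: ler_sum => i _; rewrite indicE.
  case: asboolP => [ci|ci]; first by rewrite mem_set//= mulr1.
  by rewrite !mulr_ge0 ?exprn_ge0.
(* The lower bound for the integral of [h] is obtained from a sum of nonnegative functions, which
   avoids integrating a difference. *)
have hb t : k%:E <= h t + \sum_(i in A) b i t.
  rewrite -leeBlDr; first by rewrite le_max lexx orbT.
  by rewrite sumEFin.
have : \int[mu]_t k%:E <= \int[mu]_t h t + \sum_(i in A) \int[mu]_t b i t.
  rewrite -big_enum/= -ge0_integral_sum// -ge0_integralD//; last 3 first.
  - by move=> t _; rewrite le_max lexx.
  - by move=> t _; exact: sume_ge0.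
  - exact: emeasurable_sum.
  by apply: le_integral_nonneg => // t; rewrite big_enum.
rewrite integral_cst//= probability_setT mule1.
under eq_bigr do rewrite ib.
rewrite sumEFin -leeBlDr// -EFinB; apply: le_trans.
rewrite lee_fin mulrBr mulr1 lerD2l lerN2 mulr_sumr.
by apply: ler_sum => i _; rewrite exprSr mulrA.
Qed.

End iterated_expectation.

(** * Convex hulls of finitely many points *)

Section hull.
Context {R : realType} {n : nat}.
Implicit Types (x : nat -> 'rV[R]_n).

Lemma measurable_closed_Rn (A : set 'rV[R]_n) :
  closed A -> measurable (A : set (Rn R n)).
Proof.
move=> cA; rewrite -(setCK A); apply: measurableC; apply: sub_sigma_algebra.
exact/closed_openC.
Qed.

Lemma measurable_compact_Rn (A : set 'rV[R]_n) :
  compact A -> measurable (A : set (Rn R n)).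
Proof. by move=> /compact_closed/(_ _) cA; apply: measurable_closed_Rn; apply: cA;
  exact: norm_hausdorff. Qed.

Lemma rV_norm_leP m (v : 'rV[R]_m) (M : R) : 0 <= M ->
  (`|v| <= M) <-> (forall i, `|v ord0 i| <= M).
Proof.
move=> M0; rewrite [X in X <= _](_ : _ = mx_norm v)// mx_normrE; split.
  by move=> /bigmax_leP[_ h] i; exact: (h (ord0, i)).
by move=> h; apply/bigmax_leP; split => // -[i j] _ /=; rewrite ord1.
Qed.

Lemma continuous_sum (T : topologicalType) (V : normedModType R) (N : nat) (f : 'I_N -> T -> V) :
  (forall i, continuous (f i)) -> continuous (fun w => \sum_(i < N) f i w).
Proof.
by move=> cf; apply: continuous_big => // -[x y]; exact: add_continuous.
Qed.

Lemma mink_comb_compact (l : R) (K1 K2 : set 'rV[R]_n) :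
  compact K1 -> compact K2 -> compact (mink_comb l K1 K2).
Proof.
move=> c1 c2.
rewrite (_ : mink_comb _ _ _ = (fun z : 'rV[R]_n * 'rV[R]_n => l *: z.1 + (1 - l) *: z.2)
  @` (K1 `*` K2)).
  apply: continuous_compact; last exact: compact_setX.
  by apply: continuous_subspaceT => z; apply: cvgD; apply: cvgZl_tmp;
    [exact: cvg_fst|exact: cvg_snd].
apply/seteqP; split => [_ [x Kx [y Ly <-]]|_ [[x y] [Kx Ly] <-]].
  by exists (x, y).
by exists x => //; exists y.
Qed.

(** The hull is the continuous image of the simplex [S] of weights, which is closed and bounded.
    Compactness also makes the hull measurable. *)
Lemma hullN_compact (N : nat) x : compact (hullN N x).
Proof.
pose S := [set w : 'rV[R]_N | (forall i, 0 <= w ord0 i) /\ \sum_(i < N) w ord0 i = 1].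
have cS : compact S.
  apply: bounded_closed_compact.
    exists 1; split => // M M1 w [w0 w1].
    apply/rV_norm_leP => [|j]; first by rewrite ltW// (lt_trans ltr01).
    rewrite ger0_norm//; apply: le_trans (ltW M1).
    by rewrite -w1 (bigD1 j)//= lerDl; apply: sumr_ge0.
  rewrite (_ : S = \bigcap_i [set w : 'rV[R]_N | 0 <= w ord0 i] `&` [set w :
    'rV[R]_N | \sum_(i < N) w ord0 i = 1]); last first.
    by apply/seteqP; split => w [] h1 h2; split => // i; move: (h1 i); [|apply].
  apply: closedI.
    apply: closed_bigI => i _.
    apply: (@closed_comp _ _ (fun w : 'rV[R]_N => w ord0 i) [set r | 0 <= r]);
      last exact: closed_ge.
    by move=> w _; exact: coord_continuous.
  apply: (@closed_comp _ _ (fun w : 'rV[R]_N => \sum_(i < N) w ord0 i) [set r | r = 1]);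
    last exact: closed_eq.
  by move=> w _; apply: (@continuous_sum _ R^o) => i; exact: coord_continuous.
rewrite (_ : hullN N x = (fun w : 'rV[R]_N => \sum_(i < N) w ord0 i *: x i) @` S).
  apply: continuous_compact => //; apply: continuous_subspaceT => w.
  apply: continuous_sum => i v.
  have h := @coord_continuous R 1 N ord0 i v.
  exact: (cvgZr_tmp h).
apply/seteqP; split => [y [w [w0 [w1 ->]]]|_ [w [w0 w1] <-]].
  exists (\row_(i < N) w i) => /=.
    by split; [move=> i; rewrite mxE|rewrite -[RHS]w1; apply: eq_bigr => i _; rewrite mxE].
  by apply: eq_bigr => i _; rewrite mxE.
exists (fun i => if insub i is Some j then w ord0 j else 0); split.
  by move=> i; case: insubP.
by split; [rewrite -[RHS]w1|]; apply: eq_bigr => i _; rewrite valK.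
Qed.

Lemma hullN_vertex (N k : nat) x : (k < N)%N -> hullN N x (x k).
Proof.
move=> kN; exists (fun i => (i == k)%:R); split => //; split.
  rewrite (bigD1 (Ordinal kN))//= eqxx big1 ?addr0// => i /negPf ik.
  by rewrite [_ == _](_ : _ = false)// -[RHS]ik.
rewrite (bigD1 (Ordinal kN))//= eqxx scale1r big1 ?addr0// => i /negPf ik.
by rewrite [_ == _](_ : _ = false) ?scale0r// -[RHS]ik.
Qed.

Lemma hullN_convex (N m : nat) x (w : 'I_m -> R) (y : 'I_m -> 'rV[R]_n) :
  (forall i, 0 <= w i) -> \sum_i w i = 1 -> (forall i, hullN N x (y i)) ->
  hullN N x (\sum_i w i *: y i).
Proof.
move=> w0 w1 hy; have [v hv] := choice hy.
exists (fun k => \sum_i w i * v i k); split.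
  by move=> k; apply: sumr_ge0 => i _; apply: mulr_ge0 => //; case: (hv i).
split.
  rewrite exchange_big/= -w1; apply: eq_bigr => i _.
  by rewrite -mulr_sumr; case: (hv i) => _ [-> _]; rewrite mulr1.
transitivity (\sum_i \sum_(k < N) (w i * v i k) *: x k).
  apply: eq_bigr => i _; case: (hv i) => _ [_ ->].
  by rewrite scaler_sumr; apply: eq_bigr => k _; rewrite scalerA.
by rewrite exchange_big/=; apply: eq_bigr => k _; rewrite scaler_suml.
Qed.

End hull.

(** * Slabs under a log-concave measure *)

Section real_valued_probability.
Context {d : measure_display} {T : measurableType d} {R : realType}.
Variable mu : probability T R.
Local Notation P A := (fine (mu A)).
Implicit Types A B : set T.

Lemma prob_ge0 A : 0 <= P A.
Proof. by rewrite fine_ge0. Qed.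

Lemma prob_fineK A : measurable A -> (P A)%:E = mu A.
Proof. by move=> mA; rewrite fineK// fin_num_measure. Qed.

Lemma prob_le1 A : measurable A -> P A <= 1.
Proof. by move=> mA; rewrite -lee_fin prob_fineK// probability_le1. Qed.

Lemma prob_le A B : measurable A -> measurable B -> A `<=` B -> P A <= P B.
Proof. by move=> mA mB AB; rewrite -lee_fin !prob_fineK// le_measure// inE. Qed.

Lemma probC A : measurable A -> P (~` A) = 1 - P A.
Proof.
by move=> mA; rewrite probability_setC// -prob_fineK.
Qed.

Lemma prob_leU A B Z : measurable A -> measurable B -> measurable Z ->
  Z `<=` A `|` B -> P Z <= P A + P B.
Proof.
move=> mA mB mZ ZAB; rewrite -lee_fin EFinD !prob_fineK//.
apply: (@le_trans _ _ (mu (A `|` B))).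
  by rewrite le_measure// inE//; exact: measurableU.
exact: measureU2.
Qed.

Lemma prob_le_sum (I : finType) (Q : pred I) (A : I -> set T) Z :
  (forall i, measurable (A i)) -> measurable Z ->
  Z `<=` [set x | exists2 i, Q i & A i x] -> P Z <= \sum_(i | Q i) P (A i).
Proof.
move=> mA mZ ZA.
apply: (@le_trans _ _ (P (\big[setU/set0]_(i | Q i) A i))).
  apply: prob_le => //; first exact: bigsetU_measurable.
  by move=> x /ZA[i Qi Aix]; rewrite (bigD1 i)//=; left.
suff [//] : measurable (\big[setU/set0]_(i | Q i) A i) /\ P (\big[setU/set0]_(i | Q i) A i)
  <= \sum_(i | Q i) P (A i).
elim/big_rec2 : _ => [|i y B Qi [mB IH]]; first by rewrite measure0.
split; first exact: measurableU.
apply: le_trans (lerD (lexx _) IH).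
by apply: prob_leU => //; exact: measurableU.
Qed.

Lemma prob_bigcup_approx (F : (set T)^nat) (e : R) : 0 < e ->
  (forall i, measurable (F i)) -> nondecreasing_seq F ->
  exists k, P (\bigcup_i F i) <= P (F k) + e.
Proof.
move=> e0 mF ndF; have mU : measurable (\bigcup_i F i) by exact: bigcupT_measurable.
have /fine_cvgP[_] : mu \o F @ \oo --> (P (\bigcup_i F i))%:E.
  by rewrite prob_fineK//; exact: nondecreasing_cvg_mu.
move=> /cvgrPdist_le/(_ e e0)[k _ /(_ k (leqnn _))] /=.
by rewrite ler_norml => /andP[_ h]; exists k; rewrite -lerBlDl.
Qed.

Lemma prob_bigcap_approx (F : (set T)^nat) (e : R) : 0 < e ->
  (forall i, measurable (F i)) -> nonincreasing_seq F ->
  exists k, P (F k) <= P (\bigcap_i F i) + e.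
Proof.
move=> e0 mF niF; have [||k hk] := @prob_bigcup_approx (fun i => ~` F i) e e0.
- by move=> i; exact: measurableC.
- by move=> i j ij; apply/subsetPset; apply: subsetC; apply/subsetPset; exact: niF.
exists k; move: hk; rewrite -setC_bigcap !probC//; last exact: bigcapT_measurable.
lra.
Qed.

End real_valued_probability.

(** * Linear functionals and slabs *)

Section dot.
Context {R : realType} {n : nat}.
Implicit Types (a x y : 'rV[R]_n).

Definition dot a x : R := \sum_(i < n) a ord0 i * x ord0 i.

Lemma dotDr a x y : dot a (x + y) = dot a x + dot a y.
Proof. by rewrite -big_split; apply: eq_bigr => i _; rewrite mxE mulrDr. Qed.

Lemma dotDl a x y : dot (a + x) y = dot a y + dot x y.
Proof. by rewrite -big_split; apply: eq_bigr => i _; rewrite mxE mulrDl. Qed.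

Lemma dotZr a k x : dot a (k *: x) = k * dot a x.
Proof. by rewrite mulr_sumr; apply: eq_bigr => i _; rewrite mxE mulrCA. Qed.

Lemma dotZl a k x : dot (k *: a) x = k * dot a x.
Proof. by rewrite mulr_sumr; apply: eq_bigr => i _; rewrite mxE mulrA. Qed.

Lemma dotNr a x : dot a (- x) = - dot a x.
Proof. by rewrite -scaleN1r dotZr mulN1r. Qed.

Lemma dotNl a x : dot (- a) x = - dot a x.
Proof. by rewrite -scaleN1r dotZl mulN1r. Qed.

Lemma rV_norm_coord x i : `|x ord0 i| <= `|x|.
Proof. by move: i; apply/rV_norm_leP. Qed.

Lemma dot_norm a x : `|dot a x| <= n%:R * `|a| * `|x|.
Proof.
apply: le_trans (ler_norm_sum _ _ _) _.
rewrite -mulrA -[n in n%:R]card_ord -sum1_card natr_sum mulr_suml; apply: ler_sum => i _.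
by rewrite mul1r normrM ler_pM// rV_norm_coord.
Qed.

Lemma dot_continuous a : continuous (dot a).
Proof.
apply: (@continuous_sum R _ R^o) => i x.
have h := @coord_continuous R 1 n ord0 i x.
exact: (cvgZl_tmp (V:=R^o) h).
Qed.

Definition slab a (b r : R) : set 'rV[R]_n := [set x | `|dot a x - b| <= r].

Lemma closed_dist_dot (D : set R) a b : closed D ->
  closed [set x | D `|dot a x - b|].
Proof.
move=> cD; apply: (@closed_comp _ _ (fun x => `|dot a x - b|) D) => // x _.
apply: (@continuous_comp _ _ _ (fun x => dot a x - b) Num.norm); last exact: norm_continuous.
exact: (cvgB (@dot_continuous a x) (cvg_cst b)).
Qed.

Lemma measurable_slab a b r : measurable (slab a b r : set (Rn R n)).
Proof. by apply: measurable_closed_Rn; apply: (@closed_dist_dot [set t | t <= r]);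
  exact: closed_le. Qed.

Lemma slabS a b r r' : r <= r' -> slab a b r `<=` slab a b r'.
Proof. by move=> rr x /= /le_trans; apply. Qed.

Lemma slabZ a b r k : 0 < k -> slab (k *: a) (k * b) (k * r) = slab a b r.
Proof.
move=> k0; apply/seteqP; split => x; rewrite /slab/= dotZl -mulrBr normrM gtr0_norm//.
  by rewrite ler_pM2l.
by rewrite ler_pM2l.
Qed.

Lemma compact_rV_ball (x : 'rV[R]_n) (r : R) : compact [set y | `|y - x| <= r].
Proof.
apply: bounded_closed_compact.
  exists (`|x| + r); split; first by rewrite num_real.
  move=> M hM y /= hy; apply: le_trans (ltW hM).
  by rewrite -[y](subrK x) addrC (le_trans (ler_normD _ _))// lerD2l.
apply: (@closed_comp _ _ (fun y => `|y - x|) [set t | t <= r]); last exact: closed_le.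
move=> y _.
apply: (@continuous_comp _ _ _ (fun y => y - x) Num.norm); last exact: norm_continuous.
exact: (cvgD (@cvg_id _ (nbhs y)) (cvg_cst (- x))).
Qed.

Lemma compact_rV_norm (r : R) : compact [set x : 'rV[R]_n | `|x| <= r].
Proof.
rewrite (_ : [set _ | _] = [set y | `|y - 0| <= r]); first exact: compact_rV_ball.
by apply/seteqP; split => x; rewrite /= subr0.
Qed.

Lemma measurable_rV_norm (r : R) :
  measurable ([set x : 'rV[R]_n | `|x| <= r] : set (Rn R n)).
Proof. by apply: measurable_compact_Rn; exact: compact_rV_norm. Qed.

End dot.

Section log_concave_measure.
Context {R : realType} {n : nat} (mu : probability (Rn R n) R).
Local Notation P A := (fine (mu A)).
Implicit Types (a x y : 'rV[R]_n) (A B : set 'rV[R]_n).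

Lemma prob_tight (e : R) : 0 < e ->
  exists2 M, 0 < M & 1 - e <= P [set x : 'rV[R]_n | `|x| <= M].
Proof.
move=> e0; pose F (k : nat) := [set x : 'rV[R]_n | `|x| <= k%:R].
have mF k : measurable (F k : set (Rn R n)) by exact: measurable_rV_norm.
have [|k] := @prob_bigcup_approx _ _ _ mu F e e0 mF.
  move=> i j ij; apply/subsetPset => x /= /le_trans; apply.
  by rewrite ler_nat.
rewrite (_ : \bigcup_i F i = setT) ?probability_setT/= => [hk|]; last first.
  apply/seteqP; split => // x _; exists (Num.truncn `|x|).+1 => //.
  by rewrite /F/= ltW// truncnS_gt.
exists k.+1%:R => //.
suff : P (F k) <= P (F k.+1) by rewrite /F; lra.
by apply: prob_le => // x /= /le_trans; apply; rewrite ler_nat.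
Qed.

(** Log-concavity is a statement about compact sets; this inner approximation carries its
    consequences over to closed sets such as slabs. *)
Lemma closed_compact_approx A (e : R) : closed A -> 0 < e ->
  exists K, [/\ compact K, K `<=` A & P A <= P K + e].
Proof.
move=> cA e0; have [M M0 hM] := prob_tight e0.
have cB : compact [set x : 'rV[R]_n | `|x| <= M] := @compact_rV_norm R n M.
have clB : closed [set x : 'rV[R]_n | `|x| <= M].
  by apply: compact_closed => //; exact: norm_hausdorff.
have mB := measurable_compact_Rn cB.
have cK : compact (A `&` [set x | `|x| <= M]).
  rewrite setIC; apply: subclosed_compact cB _; last by move=> x [].
  exact: closedI.
exists (A `&` [set x | `|x| <= M]); split => //.
have mA := measurable_closed_Rn cA.
have : P A <= P (A `&` [set x | `|x| <= M]) + P (~` [set x : 'rV[R]_n | `|x| <= M]).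
  apply: prob_leU => //; [exact: measurable_compact_Rn|exact: measurableC|].
  by move=> x Ax; have [|] := pselect (`|x| <= M); [left|right].
by rewrite probC//; lra.
Qed.

Hypothesis lc : log_concave mu.

(** Log-concavity with weight 1/2, passed from compact to closed sets; squaring replaces the powers
    by products. *)
Lemma log_concave_half A B (Z : set 'rV[R]_n) : closed A -> closed B ->
  measurable (Z : set (Rn R n)) ->
  (forall x y, A x -> B y -> Z (2^-1 *: x + 2^-1 *: y)) ->
  P A * P B <= P Z ^+ 2.
Proof.
move=> cA cB mZ ABZ; apply/ler_addgt0Pr => e e0.
(* Replacing both factors by compact approximations costs at most
   [2 * e1 + e1 ^ 2 <= 3 * e1 <= e]. *)
pose e1 := Num.min 1 (e / 3).
have e10 : 0 < e1 by rewrite lt_min ltr01 divr_gt0.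
have [K [cK KA hK]] := closed_compact_approx cA e10.
have [L [cL LB hL]] := closed_compact_approx cB e10.
have mK := measurable_compact_Rn cK; have mL := measurable_compact_Rn cL.
have := lc.1 K L 2^-1 cK cL; rewrite (_ : 1 - 2^-1 = 2^-1 :> R); last by lra.
rewrite !powR12_sqrt ?prob_ge0// => /(_ _) h.
have {}h : Num.sqrt (P K) * Num.sqrt (P L) <= P Z.
  apply: le_trans (h _) _; first by lra.
  apply: prob_le => //.
    by apply: measurable_compact_Rn; exact: mink_comb_compact.
  move=> _ [x Kx [y Ly <-]]; rewrite (_ : 1 - 2^-1 = 2^-1 :> R); last by lra.
  by apply: ABZ; [exact: KA|exact: LB].
have hKL : P K * P L <= P Z ^+ 2.
  rewrite -(sqr_sqrtr (prob_ge0 mu K)) -(sqr_sqrtr (prob_ge0 mu L)) -exprMn.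
  by rewrite ler_pXn2r// nnegrE ?mulr_ge0 ?sqrtr_ge0 ?prob_ge0.
have K0 := prob_ge0 mu K; have K1 := prob_le1 mu mK.
have L0 := prob_ge0 mu L; have L1 := prob_le1 mu mL.
have e11 : e1 <= 1 by rewrite ge_min lexx.
have e1e : e1 <= e / 3 by rewrite ge_min lexx orbT.
have : P A * P B <= (P K + e1) * (P L + e1).
  by apply: ler_pM => //; exact: prob_ge0.
nra.
Qed.

(** Borell's lemma: if [dot a x - b] has absolute value at least [4 * r] at one point and at most
    [r] at another, it has absolute value at least [3/2 * r] at their midpoint, which is thus
    outside the slab. *)
Lemma prob_slab_borell a b r : 0 < r ->
  P [set x | 4 * r <= `|dot a x - b|] * P (slab a b r) <= (1 - P (slab a b r)) ^+ 2.
Proof.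
move=> r0; rewrite -probC//; last exact: measurable_slab.
apply: log_concave_half.
- by apply: (@closed_dist_dot _ _ [set t | 4 * r <= t]); exact: closed_ge.
- by apply: (@closed_dist_dot _ _ [set t | t <= r]); exact: closed_le.
- by apply: measurableC; exact: measurable_slab.
move=> x y /= hx; rewrite /slab/= => hy; apply/negP; rewrite -ltNge dotDr !dotZr.
have -> : 2^-1 * dot a x + 2^-1 * dot a y - b = 2^-1 * ((dot a x - b) - - (dot a y - b)) by lra.
rewrite normrM ger0_norm; last lra.
have := lerB_dist (dot a x - b) (- (dot a y - b)); rewrite normrN.
lra.
Qed.

(** The midpoint of a point outside the hyperplane [H] and a point of [H] lies outside [H]. Hence
    [(1 - P H) * P H <= (1 - P H) ^ 2], and [P H < 1] allows division by [1 - P H]. *)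
Lemma prob_hyperplane_le a b : a != 0 -> P (slab a b 0) <= 2^-1.
Proof.
move=> a0; set H := slab a b 0; have mH := @measurable_slab _ _ a b 0.
have HP : P H < 1.
  have : (mu H < 1)%E.
    apply: lc.2; exists a, b; split => //; apply/seteqP; split => x;
      rewrite /H/slab/= normr_le0 subr_eq0.
      by move/eqP.
    by move=> h; apply/eqP.
  by rewrite -(prob_fineK mu mH) lte_fin.
(* The complement of [H] is open; it is exhausted by closed sets, to which the midpoint inequality
   applies. *)
pose F (k : nat) := [set x | k.+1%:R^-1 <= `|dot a x - b|].
have cF k : closed (F k) by apply: (@closed_dist_dot _ _ [set t | k.+1%:R^-1 <= t]);
  exact: closed_ge.
have FU : \bigcup_k F k = ~` H.
  apply/seteqP; split => [x [k _ /= hk] hx|x /negP].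
    by have := le_trans hk hx; rewrite leNgt invr_gt0 ltr0Sn.
  rewrite -ltNge => hx; exists (Num.truncn (`|dot a x - b|^-1)) => //=.
  by rewrite /F/= -[leRHS]invrK lef_pV2 ?posrE ?invr_gt0// ltW// truncnS_gt.
have h k : P (F k) * P H <= (1 - P H) ^+ 2.
  rewrite -probC//; apply: log_concave_half => //; last first.
  - move=> x y hx; rewrite /H /slab/= normr_le0 subr_eq0 => /eqP hy.
    apply/negP; rewrite -ltNge dotDr !dotZr hy.
    have -> : 2^-1 * dot a x + 2^-1 * b - b = 2^-1 * (dot a x - b) by lra.
    by rewrite normrM mulr_gt0 ?normr_gt0 ?invr_eq0// -normr_gt0 (lt_le_trans _ hx).
  - exact: measurableC.
  - by apply: (@closed_dist_dot _ _ [set t | t <= 0]); exact: closed_le.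
have H0 := prob_ge0 mu H.
have h' : (1 - P H) * P H <= (1 - P H) ^+ 2.
  apply/ler_addgt0Pr => e e0.
  have [||k] := @prob_bigcup_approx _ _ _ mu F e e0; rewrite ?FU ?probC//.
  - by move=> i; exact: measurable_closed_Rn.
  - move=> i j ij; apply/subsetPset => x /=; apply: le_trans.
    by rewrite lef_pV2 ?posrE// ler_nat.
  move=> hk; have := h k; nra.
nra.
Qed.

End log_concave_measure.

(** * A good position *)

Section determinant_bounds.
Context {R : realType} {n : nat}.

(** Cramer's rule: the matrix is [N *m M], where [N] is the identity with row [i] replaced by [c],
    and [\det N = c ord0 i]. *)
Lemma det_replace_row (M : 'M[R]_n) (c : 'rV[R]_n) (i : 'I_n) :
  \det (\matrix_k (if k == i then c *m M else row k M)) = c ord0 i * \det M.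
Proof.
pose N : 'M[R]_n := \matrix_k (if k == i then c else delta_mx ord0 k).
rewrite [X in \det X](_ : _ = N *m M); last first.
  apply/row_matrixP => k; rewrite row_mul !rowK; case: eqP => // _.
  by rewrite rowE.
rewrite det_mulmx; congr (_ * _).
rewrite (expand_det_col _ i) (bigD1 i)//= big1 ?addr0 => [|k /negPf ki]; last first.
  by rewrite !mxE ki !mxE eqxx/= eq_sym ki mul0r.
rewrite !mxE eqxx /cofactor -signr_odd oddD addbb expr0 mul1r.
rewrite [X in \det X](_ : _ = 1%:M) ?det1 ?mulr1//.
apply/matrixP => k l; rewrite !mxE.
have /negPf -> : lift i k != i by rewrite eq_sym neq_lift.
by rewrite !mxE eqxx/= (inj_eq (@lift_inj _ i)) eq_sym.
Qed.

Lemma det_norm_le (M : 'M[R]_n) (B : R) : (forall i j, `|M i j| <= B) ->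
  `|\det M| <= n`!%:R * B ^+ n.
Proof.
move=> MB; apply: le_trans (ler_norm_sum _ _ _) _.
rewrite -perm.card_Sn -sum1_card natr_sum mulr_suml big_mkcond/=; apply: ler_sum => s _.
rewrite mul1r normrMsign normr_prod -[n in _ ^+ n]card_ord -prodr_const.
by apply: ler_prod => i _; rewrite normr_ge0 MB.
Qed.

End determinant_bounds.

Section position.
Context {R : realType} {n : nat} (mu : probability (Rn R n) R).
Hypothesis lc : log_concave mu.
Local Notation P A := (fine (mu A)).
Implicit Types (a x y : 'rV[R]_n) (A B : set 'rV[R]_n).

(** Hyperplanes have mass at most 1/2, so near each [(a, b)] thin slabs have mass less than 7/8;
    compactness of the unit sphere times a segment makes the width uniform. For larger [b] the slab
    misses a ball of mass at least 7/8. *)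
Lemma slab_uniform : exists2 r : R, 0 < r &
  forall a b, `|a| = 1 -> P (slab a b r) < 7 / 8.
Proof.
have e8 : 0 < 8^-1 :> R by [].
have [M M0 hM] := prob_tight mu e8.
have mB := @measurable_rV_norm R n M.
(* For [a] of norm 1, [dot a x] is at most [n * M] in absolute value on the ball, so a slab of
   half-width at most 1 with [b] beyond [L] misses the ball. *)
pose L := n%:R * M + 1.
have L0 : 0 <= n%:R * M by rewrite mulr_ge0// ltW.
have cK : compact ([set a : 'rV[R]_n | `|a| = 1] `*` `[- L, L]%classic).
  apply: compact_setX; last exact: segment_compact.
  apply: bounded_closed_compact.
    by exists 1; split => // N N1 a /= ->; exact: ltW.
  apply: (@closed_comp _ _ (fun a : 'rV[R]_n => `|a|) [set t : R | t = 1]); last exact: closed_eq.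
  by move=> x _; exact: norm_continuous.
have key : \forall r \near 0^'+, ([set a : 'rV[R]_n | `|a| = 1] `*` `[- L, L]%classic) `<=`
    [set z | P (slab z.1 z.2 r) < 7 / 8].
  apply: (iffLR (compact_near_coveringP _) cK) => -[a b] [/= a1 _].
  have a0 : a != 0 by rewrite -normr_gt0 a1.
  have [||k hk] := @prob_bigcap_approx _ _ _ mu (fun k : nat => slab a b k.+1%:R^-1) 8^-1 e8.
  - by move=> i; exact: measurable_slab.
  - by move=> i j ij; apply/subsetPset; apply: slabS; rewrite lef_pV2 ?posrE// ler_nat.
  have {}hk : P (slab a b k.+1%:R^-1) <= 5 / 8.
    apply: le_trans hk _; have := prob_hyperplane_le lc b a0.
    rewrite [\bigcap_i _](_ : _ = slab a b 0); first lra.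
    apply/seteqP; split => x; last by move=> h i _; apply: slabS h; rewrite invr_ge0.
    move=> h; rewrite /slab/= leNgt; apply/negP => hx.
    have := h (Num.truncn (`|dot a x - b|^-1)) I.
    rewrite /slab/= leNgt => /negP; apply.
    by rewrite -[ltRHS]invrK ltf_pV2 ?posrE ?invr_gt0// truncnS_gt.
  set r0 := k.+1%:R^-1 in hk.
  have r00 : 0 < r0 by rewrite invr_gt0.
  (* Moving [(a, b)] by less than [e] changes [dot a x - b] by at most [r0 / 2] on the ball, so
     there the new slabs of half-width [r0 / 4] stay inside the old one of half-width [r0]. *)
  pose e := Num.min (r0 / 4 / L) (r0 / 4).
  have L1 : 0 < L by rewrite /L; lra.
  have e0 : 0 < e by rewrite lt_min !divr_gt0.
  exists (ball (a, b) e, [set r | r <= r0 / 4]).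
    split; first exact: nbhsx_ballx.
    by apply: nbhs_right_le; rewrite divr_gt0.
  move=> [[a' b'] r] /= [[ha hb] hr].
  have {}ha : `|a - a'| < e by move: ha; rewrite -ball_normE.
  have {}hb : `|b - b'| < e by move: hb; rewrite -ball_normE.
  have : P (slab a' b' r) <= P (slab a b r0) + P (~` [set x : 'rV[R]_n | `|x| <= M]).
    apply: prob_leU; [exact: measurable_slab|exact: measurableC|exact: measurable_slab|].
    move=> x; rewrite /slab/= => hx.
    have [xM|] := pselect (`|x| <= M); [left|by right].
    have -> : dot a x - b = (dot a' x - b') + (dot (a - a') x - (b - b')).
      by rewrite dotDl dotNl; lra.
    have h1 : `|dot (a - a') x| <= r0 / 4.
      apply: le_trans (dot_norm _ _) _.
      have : `|a - a'| <= r0 / 4 / L by apply: le_trans (ltW ha) _; rewrite ge_min lexx.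
      rewrite ler_pdivlMr// => h; apply: le_trans h.
      rewrite [n%:R * _]mulrC -mulrA ler_wpM2l// (@le_trans _ _ (n%:R * M))//.
        by rewrite ler_wpM2l.
      by rewrite /L lerDl.
    have h2 : `|b - b'| <= r0 / 4 by apply: le_trans (ltW hb) _; rewrite ge_min lexx orbT.
    apply: le_trans (ler_normD _ _) _.
    have := ler_normB (dot (a - a') x) (b - b').
    move: hx h1 h2; lra.
  by rewrite probC//; lra.
have [r [[r0 r1] hr]] : exists r : R, (0 < r /\ r <= 1) /\
    (([set a : 'rV[R]_n | `|a| = 1] `*` `[- L, L]%classic) `<=`
    [set z | P (slab z.1 z.2 r) < 7 / 8]).
  have k1 : \forall r \near (0 : R)^'+, 0 < r by exact: nbhs_right_gt.
  have k2 : \forall r \near (0 : R)^'+, r <= 1 by exact: nbhs_right_le.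
  exact: (filter_ex (filterI (filterI k1 k2) key)).
exists r => // a b a1.
have [bL|bL] := leP `|b| L.
  by apply: (hr (a, b)); split => //=; rewrite in_itv/= -ler_norml.
apply: (@le_lt_trans _ _ (P (~` [set x : 'rV[R]_n | `|x| <= M]))).
  apply: prob_le; [exact: measurable_slab|exact: measurableC|].
  move=> x; rewrite /slab/= => hx xM.
  have := dot_norm a x; rewrite a1 mulr1 => h.
  have h2 : n%:R * `|x| <= n%:R * M by rewrite ler_wpM2l.
  have := lerB_dist b (dot a x); rewrite distrC.
  by move: hx h h2 bL r1; rewrite /L; lra.
by rewrite probC//; lra.
Qed.

Lemma dot_mulmx a x (T : 'M[R]_n) : dot a (x *m T^T) = dot (a *m T) x.
Proof.
rewrite /dot; under eq_bigr do rewrite mxE mulr_sumr.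
rewrite exchange_big/=; apply: eq_bigr => i _; rewrite mxE mulr_suml.
by apply: eq_bigr => j _; rewrite mxE; ring.
Qed.

(* The directions whose slab of half-width [1] can carry mass [1 - p] form a bounded star body;
   a basis of nearly maximal determinant in it dominates, up to a factor 2, every other
     direction. *)
Lemma log_concave_position (p : R) : 0 < p -> p <= 8^-1 ->
  exists (A : 'M[R]_n) (c : 'rV[R]_n), [/\ A \in unitmx,
    forall j, 1 - p <= P [set x : 'rV[R]_n | `|(x *m A - c) ord0 j| <= 1] &
    forall a b, `|a| = 1 ->
      P [set x : 'rV[R]_n | `|dot a (x *m A - c) - b| <= 3^-1] < 1 - p].
Proof.
move=> p0 p8; have [r r0 hr] := slab_uniform.
pose W a := exists b, 1 - p <= P (slab a b 1).
have WB a : W a -> `|a| <= r^-1.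
  move=> [b hb]; rewrite leNgt; apply/negP => ha.
  have a0 : 0 < `|a| by rewrite (lt_trans _ ha)// invr_gt0.
  have := hr (`|a|^-1 *: a) (`|a|^-1 * b).
  rewrite normrZ normfV normr_id mulVf ?gt_eqF// => /(_ erefl).
  apply/negP; rewrite -leNgt; apply: (@le_trans _ _ (1 - p)); first lra.
  apply: le_trans hb _; apply: prob_le; [exact: measurable_slab..|].
  rewrite -(@slabZ _ _ a b 1 `|a|^-1) ?invr_gt0//; apply: slabS.
  by rewrite mulr1 -[leRHS]invrK lef_pV2 ?posrE ?invr_gt0// ltW.
pose D := [set `|\det T| | T in [set T : 'M[R]_n | forall i, W (row i T)]].
have [M M0 hM] := prob_tight mu p0.
(* By tightness the coordinate directions scaled by [M^-1] belong to [W], so the supremum of the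
   determinants is positive. *)
have [T0 WT0 dT0] : exists2 T : 'M[R]_n, (forall i, W (row i T)) & 0 < `|\det T|.
  exists (M^-1)%:M; last by rewrite det_scalar normr_gt0 expf_neq0// invr_eq0 gt_eqF.
  move=> i; exists 0; apply: le_trans hM _; apply: prob_le;
    [exact: measurable_rV_norm|exact: measurable_slab|].
  move=> x /= xM; rewrite /slab/= subr0 /dot (bigD1 i)//= big1 ?addr0.
    rewrite !mxE eqxx mulr1n normrM gtr0_norm ?invr_gt0// mulrC ler_pdivrMr// mul1r.
    exact: le_trans (rV_norm_coord _ _) xM.
  by move=> j /negPf ji; rewrite !mxE eq_sym ji mulr0n mul0r.
have hD : has_sup D.
  split; first by exists `|\det T0|, T0.
  exists (n`!%:R * r^-1 ^+ n) => _ [T WT <-]; apply: det_norm_le => i j.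
  have := WB _ (WT i); apply: le_trans.
  by have := rV_norm_coord (row i T) j; rewrite mxE.
have supD : 0 < sup D by apply: lt_le_trans dT0 _; apply: (sup_upper_bound hD); exists T0.
have [_ [T WT <-] dT] := @sup_adherent _ D (sup D / 2) (divr_gt0 supD (ltr0Sn _ _)) hD.
have {}dT : sup D / 2 < `|\det T| by lra.
have dT0' : 0 < `|\det T| by lra.
have [c hc] := choice WT.
(* By Cramer's rule the coordinate is a ratio of two determinants: the numerator is at most [sup D],
   the denominator more than half of it. *)
have Wcoord a : W (a *m T) -> forall i, `|a ord0 i| <= 2.
  move=> Wa i.
  have : `|a ord0 i * \det T| <= sup D.
    rewrite -det_replace_row; apply: (sup_upper_bound hD); eexists; last reflexivity.
    by move=> k; rewrite /= rowK; case: eqP.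
  rewrite normrM => h; rewrite -(ler_pM2r dT0'); lra.
exists T^T, (\row_j c j); split.
- by rewrite unitmx_tr unitmxE unitfE -normr_gt0.
- move=> j; apply: le_trans (hc j) _; apply: prob_le; [exact: measurable_slab| |].
    rewrite (_ : [set _ | _] = slab (row j T) (c j) 1); first exact: measurable_slab.
    apply/seteqP; split => x; rewrite /slab/= !mxE /dot;
    under eq_bigr do rewrite !mxE mulrC; by under [X in _ -> is_true (`|X - _| <= _)]eq_bigr do
      rewrite !mxE.
  move=> x; rewrite /slab/= !mxE /dot.
  by under eq_bigr do rewrite mxE mulrC; under [X in _ -> is_true (`|X - _| <= _)]eq_bigr do
    rewrite mxE.
- move=> a b a1; rewrite ltNge; apply/negP => h.
  (* A heavy slab of half-width 1/3, scaled by 3, puts the direction [(3 *: a) *m T] in [W]. The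
     coordinates of [3 *: a] are then at most 2, against the norm 1 of [a]. *)
  have Wa : W ((3 *: a) *m T).
    exists (3 * (b + dot a (\row_j c j))); apply: le_trans h _.
    rewrite (_ : [set _ | _] = slab (3 *: a *m T) (3 * (b + dot a (\row_j c j))) 1)//.
    rewrite -scalemxAl -[X in slab _ _ X](@mulfV R 3)// slabZ//.
    by apply/seteqP; split => x; rewrite /slab/= dotDr dotNr dot_mulmx opprD [- b - _]addrC addrA.
  have : `|a| <= 2 / 3.
    apply/rV_norm_leP => [|i]; first lra.
    have := Wcoord _ Wa i; rewrite mxE normrM ger0_norm; lra.
  by rewrite a1; lra.
Qed.

End position.

(** * Fat simplices *)

Section simplex.
Context {R : realType} {n : nat}.
Implicit Types (a x y : 'rV[R]_n).

Lemma dot_suml (I : finType) (w : I -> R) (v : I -> 'rV[R]_n) a :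
  dot a (\sum_i w i *: v i) = \sum_i w i * dot a (v i).
Proof.
elim/big_rec2 : _ => [|i y z _ <-]; last by rewrite dotDr dotZr.
by rewrite /dot big1// => i _; rewrite mxE mulr0.
Qed.

Lemma mulmx_dot (M : 'M[R]_n) a k : (a *m M^T) ord0 k = dot a (row k M).
Proof. by rewrite mxE; apply: eq_bigr => i _; rewrite !mxE. Qed.

(** Among the tuples from [H], take one whose differences from a fixed point [q i0] have maximal
    determinant. All other differences have coordinates at most 1 in this basis, so if every edge
    were short along [a], all the points would lie in a slab of half-width [r] for the normalized
    direction. *)
Lemma exists_simplex (I : finType) (H : {set I}) (q : I -> 'rV[R]_n) (r : R) :
  (0 < n)%N -> 0 < r ->
  (forall a b, `|a| = 1 -> exists2 i, i \in H & r < `|dot a (q i) - b|) ->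
  exists2 f : 'I_n.+1 -> I, (forall k, f k \in H) &
    forall a, exists k, `|a| * (r / n%:R) <=
                `|dot a (q (f (lift ord0 k)) - q (f ord0))|.
Proof.
move=> n0 r0 Hq.
have nR : 0 < n%:R :> R by rewrite ltr0n.
have Hq' a b : a != 0 -> exists2 i, i \in H & `|a| * r < `|dot a (q i) - b|.
  rewrite -normr_gt0 => a0; have [|i iH hi] := Hq (`|a|^-1 *: a) (`|a|^-1 * b).
    by rewrite normrZ normfV normr_id mulVf ?gt_eqF.
  exists i => //; move: hi; rewrite dotZl -mulrBr normrM normfV normr_id.
  by rewrite mulrC ltr_pdivlMr// mulrC.
have [i0 i0H] : exists i0, i0 \in H.
  have [|i iH _] := Hq' (const_mx 1) 0; last by exists i.
  apply/eqP => /matrixP/(_ ord0 (Ordinal n0)); rewrite !mxE => /eqP.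
  by rewrite oner_eq0.
pose Q (f : {ffun 'I_n -> I}) : 'M[R]_n := \matrix_k (q (f k) - q i0).
have [f0 f0H f0det] : exists2 f : {ffun 'I_n -> I},
    [forall k, f k \in H] & \det (Q f) != 0.
  pose M : 'M[R]_(#|I|, n) :=
    \matrix_k (if enum_val k \in H then q (enum_val k) - q i0 else 0).
  (* A nonzero vector orthogonal to all the differences would put the points in a hyperplane. The
     zero rows of [M], at indices outside [H], cannot enter an invertible submatrix. *)
  have fM : row_full M.
    rewrite /row_full -mxrank_tr; apply: (iffLR (rwP idP)).
    change (row_free M^T); rewrite -kermx_eq0; apply/rowV0P => v /sub_kermxP vM.
    apply/eqP/negP => /negP v0; have [i iH] := Hq' v (dot v (q i0)) v0.
    have /matrixP/(_ ord0 (enum_rank i)) := vM.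
    rewrite !mxE => h; rewrite -dotNr -dotDr => /lt_geF/negP; apply.
    rewrite [dot _ _](_ : _ = 0); first by rewrite normr0 mulr_ge0// ltW.
    by rewrite -[RHS]h; apply: eq_bigr => k _; rewrite !mxE enum_rankK iH !mxE.
  have [g uM] : exists g : 'I_n -> 'I_#|I|, rowsub g M \in unitmx.
    by exists (fullrankfun fM); rewrite -row_full_unit fullrowsub_full.
  have gH k : enum_val (g k) \in H.
    apply/negPn/negP => /negPf kH.
    move: uM; rewrite unitmxE unitfE (expand_det_row _ k) big1 ?eqxx// => j _.
    by rewrite !mxE kH mxE mul0r.
  exists [ffun k => enum_val (g k)]; first by apply/forallP => k; rewrite ffunE.
  move: uM; rewrite unitmxE unitfE; congr (\det _ != 0).
  by apply/matrixP => k j; rewrite !mxE ffunE gH !mxE.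
case: (@arg_maxP _ _ _ f0 (fun f : {ffun 'I_n -> I} => [forall k, f k \in H])
  (fun f => `|\det (Q f)|) f0H) => f /forallP fH fmax.
have fdet : 0 < `|\det (Q f)|.
  by apply: lt_le_trans (fmax _ f0H); rewrite normr_gt0.
exists (fun k => if unlift ord0 k is Some j then f j else i0).
  by move=> k; case: unlift.
move=> a; rewrite unlift_none; under eq_exists => k do rewrite liftK.
have [->|a0] := eqVneq a 0.
  by exists (Ordinal n0); rewrite normr0 mul0r.
have [i iH hi] := Hq' a (dot a (q i0)) a0.
have uQ : Q f \in unitmx by rewrite unitmxE unitfE -normr_gt0.
pose c := (q i - q i0) *m invmx (Q f).
have cQ : c *m Q f = q i - q i0 by rewrite mulmxKV.
have c1 k : `|c ord0 k| <= 1.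
  rewrite -(ler_pM2r fdet) mul1r -normrM -det_replace_row cQ.
  pose f' := [ffun j => if j == k then i else f j].
  rewrite [X in \det X](_ : _ = Q f'); last first.
    by apply/row_matrixP => j; rewrite !rowK ffunE; case: eqP.
  by apply: fmax; apply/forallP => j; rewrite ffunE; case: eqP.
apply/not_existsP => hk.
move: hi; apply/negP; rewrite -leNgt -dotNr -dotDr -cQ mulmx_sum_row dot_suml.
apply: le_trans (ler_norm_sum _ _ _) _.
apply: (@le_trans _ _ (\sum_(k < n) `|a| * (r / n%:R))).
  apply: ler_sum => k _; rewrite normrM rowK.
  have := hk k => /negP; rewrite -ltNge => /ltW h.
  by rewrite -[leRHS]mul1r ler_pM.
by rewrite sumr_const card_ord -[_ *+ n]mulr_natr -mulrA divfK ?gt_eqF.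
Qed.

(** Replacing the vertices [q] by nearby points [v] keeps the simplex fat, so [y] minus the centroid
    has coordinates at most [1 / (n * (n + 1))] in the edge basis. Added to the equal weights
    [1 / (n + 1)], they leave all weights nonnegative. *)
Lemma simplex_contains (s rho r : R) (q v : 'I_n.+1 -> 'rV[R]_n) y :
  0 < r -> 0 <= s ->
  (forall a, exists k, `|a| * r <= `|dot a (q (lift ord0 k) - q ord0)|) ->
  (forall k, `|v k - q k| <= s) -> 4 * n%:R * s <= r ->
  `|y - n.+1%:R^-1 *: \sum_k q k| <= rho ->
  n%:R * (rho + s) * (2 / r) * (n%:R * n.+1%:R) <= 1 ->
  exists w : 'I_n.+1 -> R, [/\ forall k, 0 <= w k, \sum_k w k = 1 &
    y = \sum_k w k *: v k].
Proof.
move=> r0 s0 hq hv hs hy hrho.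
pose V : 'M[R]_n := \matrix_k (v (lift ord0 k) - v ord0).
(* An edge changes by a vector of norm at most [2 * s], whose pairing with [a] is at most half of
   the lower bound for the edge. *)
have hV a : exists k, `|a| * (r / 2) <= `|dot a (row k V)|.
  have [k hk] := hq a; exists k; rewrite rowK.
  rewrite (_ : v (lift ord0 k) - v ord0 = (q (lift ord0 k) - q ord0) -
     ((v ord0 - q ord0) - (v (lift ord0 k) - q (lift ord0 k)))); last first.
    by rewrite opprB [RHS]addrC opprB !addrA; apply/rowP => j; rewrite !mxE; ring.
  rewrite dotDr dotNr.
  set e := (v ord0 - q ord0) - _.
  have he : `|e| <= 2 * s.
    apply: le_trans (ler_normB _ _) _.
    have := hv ord0; have := hv (lift ord0 k); lra.
  have de : `|dot a e| <= `|a| * (r / 2).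
    apply: le_trans (dot_norm _ _) _; rewrite [_ * `|a|]mulrC -mulrA ler_wpM2l//.
    apply: (@le_trans _ _ (n%:R * (2 * s))); last lra.
    by rewrite ler_wpM2l.
  have := lerB_dist (dot a (q (lift ord0 k) - q ord0)) (dot a e).
  lra.
have uV : V \in unitmx.
  rewrite -unitmx_tr -row_free_unit -kermx_eq0; apply/rowV0P => a /sub_kermxP aV.
  have [k] := hV a; rewrite -mulmx_dot aV mxE normr0 => h.
  apply/eqP; rewrite -normr_le0.
  by rewrite -(pmulr_lle0 _ (divr_gt0 r0 (ltr0Sn R 1))).
pose vbar := n.+1%:R^-1 *: \sum_k v k.
pose e := y - vbar.
have he : `|e| <= rho + s.
  rewrite /e (_ : y - vbar = (y - n.+1%:R^-1 *: \sum_k q k)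
    + n.+1%:R^-1 *: \sum_k (q k - v k)); last first.
    by rewrite sumrB scalerBr addrA subrK.
  apply: le_trans (ler_normD _ _) _; apply: lerD => //.
  rewrite normrZ ger0_norm ?invr_ge0// mulrC ler_pdivrMr//.
  apply: le_trans (ler_norm_sum _ _ _) _.
  rewrite mulr_natr -[n.+1 in leRHS]card_ord -sumr_const; apply: ler_sum => k _.
  by rewrite distrC.
pose t := e *m invmx V.
have tV : \sum_k t ord0 k *: (v (lift ord0 k) - v ord0) = e.
  by rewrite -[RHS](mulmxKV uV) mulmx_sum_row; apply: eq_bigr => k _; rewrite rowK.
have ht k : `|t ord0 k| * (n%:R * n.+1%:R) <= 1.
  (* The dual basis vector [th] pairs to 1 with the [k]-th edge and to 0 with the others, so fatness
     bounds its norm by [2 / r]. *)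
  pose th := row k (invmx V)^T.
  have -> : t ord0 k = dot th e.
    by rewrite mxE; apply: eq_bigr => j _; rewrite !mxE mulrC.
  have hth : `|th| <= 2 / r.
    have [l] := hV th; rewrite -mulmx_dot.
    have -> : (th *m V^T) ord0 l = (l == k)%:R.
      rewrite /th -row_mul -trmx_mul mulmxV// trmx1 !mxE eq_sym.
      by case: eqP.
    move=> h; rewrite ler_pdivlMr//.
    have : `|(l == k)%:R : R| <= 1 by case: eqP; rewrite ?normr1 ?normr0.
    lra.
  apply: le_trans hrho; rewrite ler_wpM2r ?mulr_ge0//.
  apply: le_trans (dot_norm _ _) _.
  rewrite -!mulrA ler_wpM2l// mulrC; exact: ler_pM.
have n1 : 0 < n.+1%:R :> R by rewrite ltr0n.
(* The base vertex compensates the other corrections, keeping the total weight equal to 1. *)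
exists (fun k => n.+1%:R^-1 + (if unlift ord0 k is Some j then t ord0 j else - \sum_j t ord0 j)).
split.
- move=> k; case: unliftP => [j _|_].
    have : `|t ord0 j| <= n.+1%:R^-1.
      rewrite -[leRHS]mul1r ler_pdivlMr//; apply: le_trans (ht j).
      rewrite ler_wpM2l// ler_peMl// ler1n.
      by case: j => j /= /(leq_ltn_trans (leq0n _)).
    by rewrite ler_norml => /andP[h _]; rewrite -lerBlDl sub0r.
  rewrite subr_ge0.
  have [n0|n0] := posnP n.
    rewrite big1 ?invr_ge0// => j; exfalso.
    by case: j => j /=; rewrite n0.
  have nR : 0 < n%:R :> R by rewrite ltr0n.
  apply: (@le_trans _ _ (\sum_(j < n) (n%:R * n.+1%:R)^-1)).
    apply: ler_sum => j _; apply: le_trans (ler_norm _) _.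
    by rewrite -[leRHS]mul1r ler_pdivlMr// mulr_gt0.
  by rewrite sumr_const card_ord -[_ *+ n]mulr_natl invfM mulrA divff ?gt_eqF ?mul1r.
- rewrite big_split/= sumr_const card_ord -[_ *+ _]mulr_natr mulVf ?gt_eqF//.
  rewrite big_ord_recl unlift_none; under [X in _ + (_ + X)]eq_bigr do rewrite liftK.
  by rewrite addNr addr0.
under eq_bigr do rewrite scalerDl.
rewrite big_split/= -scaler_sumr -/vbar big_ord_recl unlift_none.
under [X in _ + (_ + X)]eq_bigr do rewrite liftK.
rewrite scaleNr scaler_suml [X in _ + X]addrC -sumrB.
under eq_bigr do rewrite -scalerBr.
by rewrite tV addrC /e subrK.
Qed.

End simplex.

(** * Cells *)

Section cells.
Context {R : realType} {n : nat} (mu : probability (Rn R n) R).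
Hypothesis lc : log_concave mu.
Local Notation P A := (fine (mu A)).
Variables (A : 'M[R]_n) (c : 'rV[R]_n) (s : R).
Hypothesis uA : A \in unitmx.
Implicit Types (a x y q : 'rV[R]_n).

Let L x := x *m A - c.

(** The norm of row vectors is the maximum norm: in the coordinates [x *m A - c] this is a cube of
    side [2 * s]. *)
Definition cell q : set 'rV[R]_n := [set x | `|x *m A - c - q| <= s].

Lemma mulmx_continuous (B : 'M[R]_n) : continuous (fun x : 'rV[R]_n => x *m B).
Proof.
rewrite (_ : (fun x => _) = (fun x : 'rV[R]_n => \sum_i x ord0 i *: row i B)).
  apply: continuous_sum => i v.
  have h := @coord_continuous R 1 n ord0 i v.
  exact: (cvgZr_tmp h).
by apply/funext => x; rewrite mulmx_sum_row.
Qed.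

Lemma cell_compact q : compact (cell q).
Proof.
rewrite (_ : cell q = (fun y => (y + c) *m invmx A) @` [set y | `|y - q| <= s]).
  apply: continuous_compact; last exact: compact_rV_ball.
  apply: continuous_subspaceT => y.
  apply: (@continuous_comp _ _ _ (fun y => y + c) (fun y => y *m invmx A));
    last exact: mulmx_continuous.
  exact: (cvgD (@cvg_id _ (nbhs y)) (cvg_cst c)).
apply/seteqP; split => [x hx|_ [y hy <-]].
  by exists (x *m A - c) => //; rewrite subrK mulmxK.
by rewrite /cell/= mulmxKV// addrK.
Qed.

Lemma measurable_cell q : measurable (cell q : set (Rn R n)).
Proof. by apply: measurable_compact_Rn; exact: cell_compact. Qed.

Lemma cell_convex (l : R) q q' : 0 < l < 1 ->
  mink_comb l (cell q) (cell q') `<=` cell (l *: q + (1 - l) *: q').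
Proof.
move=> /andP[l0 l1] _ [x hx [y hy <-]]; rewrite /cell/=.
rewrite (_ : _ - _ - _ = l *: (x *m A - c - q) + (1 - l) *: (y *m A - c - q')); last first.
  by rewrite mulmxDl -!scalemxAl; apply/rowP => j; rewrite !mxE; ring.
apply: le_trans (ler_normD _ _) _; rewrite !normrZ !gtr0_norm; [|lra|lra].
have : l * `|x *m A - c - q| <= l * s by rewrite ler_wpM2l// ltW.
have : (1 - l) * `|y *m A - c - q'| <= (1 - l) * s by rewrite ler_wpM2l// subr_ge0 ltW.
lra.
Qed.

(** A weighted geometric mean of two masses at least [eta] is at least [eta], and the combination of
    two cells lies in the cell at the combined centre. *)
Lemma cell_comb_mass (eta l : R) q q' : 0 < eta -> 0 < l < 1 ->
  eta <= P (cell q) -> eta <= P (cell q') ->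
  eta <= P (cell (l *: q + (1 - l) *: q')).
Proof.
move=> eta0 l01 hq hq'.
apply: (@le_trans _ _ (P (mink_comb l (cell q) (cell q')))); last first.
  apply: prob_le; [|exact: measurable_cell|exact: cell_convex].
  by apply: measurable_compact_Rn; apply: mink_comb_compact; exact: cell_compact.
have h := lc.1 (cell q) (cell q') l (@cell_compact q) (@cell_compact q') l01.
apply: le_trans h.
have /andP[l0 l1] := l01.
rewrite -[leLHS](_ : eta `^ l * eta `^ (1 - l) = eta); last first.
  rewrite -powRD; last by rewrite (gt_eqF eta0) implybT.
  by rewrite addrC subrK powRr1// ltW.
apply: ler_pM; rewrite ?powR_ge0//; apply: ge0_ler_powR; rewrite ?nnegrE ?prob_ge0//; try lra.
Qed.

(** The centres are averaged one at a time, the new one entering with weight [1 / (k + 2)]. *)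
Lemma cell_mean_mass (eta : R) (k : nat) (q : 'I_k.+1 -> 'rV[R]_n) : 0 < eta ->
  (forall i, eta <= P (cell (q i))) ->
  eta <= P (cell (k.+1%:R^-1 *: \sum_i q i)).
Proof.
move=> eta0; elim: k q => [|k IH] q hq.
  by rewrite big_ord1 invr1 scale1r.
have -> : k.+2%:R^-1 *: \sum_i q i =
    (k.+1%:R / k.+2%:R) *: (k.+1%:R^-1 *: \sum_(i < k.+1) q (widen_ord (leqnSn _) i)) +
    (1 - k.+1%:R / k.+2%:R) *: q ord_max.
  rewrite big_ord_recr/= scalerDr scalerA; congr (_ + _).
    by congr (_ *: _); rewrite mulrAC divff ?mul1r// pnatr_eq0.
  congr (_ *: _); apply: (@mulIf _ k.+2%:R); first by rewrite pnatr_eq0.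
  by rewrite mulrBl mulVf ?divfK ?pnatr_eq0// mul1r -[k.+2%:R]natr1 addrC addKr.
apply: cell_comb_mass => //; last by apply: IH.
by rewrite divr_gt0//= ltr_pdivrMr// mul1r ltr_nat.
Qed.

(* The sampled points in the cells of the simplex vertices span a simplex containing
   a neighbourhood of the mean; moving towards it absorbs the error made in replacing
   a point of a cell by the sampled one. *)
Lemma hull_contains (I : finType) (H : {set I}) (q : I -> 'rV[R]_n)
  (f : 'I_n.+1 -> I) (r e : R) (N : nat) (X : nat -> 'rV[R]_n) :
  0 < r -> 0 <= s -> 0 < e < 1 -> (forall k, f k \in H) ->
  (forall a, exists k, `|a| * r <= `|dot a (q (f (lift ord0 k)) - q (f ord0))|) ->
  4 * n%:R * s <= r ->
  n%:R * (3 * s / e + s) * (2 / r) * (n%:R * n.+1%:R) <= 1 ->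
  hit_all (fun i => cell (q i)) N H X ->
  mink_comb (1 - e) [set x | exists2 i, i \in H & cell (q i) x]
    (cell (n.+1%:R^-1 *: \sum_k q (f k))) `<=` hullN N X.
Proof.
move=> r0 s0 /andP[e0 e1] fH hf hs hr hit _ [z [i iH hz] [b hb <-]].
have [k0 k0N hk0] := hit i iH.
have [g hg] : exists g : 'I_n.+1 -> nat, forall k, (g k < N)%N /\ cell (q (f k)) (X (g k)).
  suff /choice[g hg] : forall k, exists j, (j < N)%N /\ cell (q (f k)) (X j) by exists g.
  by move=> k; have [j jN hj] := hit (f k) (fH k); exists j.
(* The sampled point [X k0] replaces [z], which lies in the same cell; [b'] absorbs the error,
   magnified by [(1 - e) / e]. *)
pose b' := b + ((1 - e) / e) *: (z - X k0).
have xE : (1 - e) *: z + (1 - (1 - e)) *: b = (1 - e) *: X k0 + e *: b'.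
  rewrite /b' scalerDr scalerA mulrCA divff ?gt_eqF// mulr1 scalerBr.
  by apply/rowP => j; rewrite !mxE; ring.
have hb' : `|L b' - n.+1%:R^-1 *: \sum_k q (f k)| <= 3 * s / e.
  rewrite (_ : L b' - _ = (b *m A - c - n.+1%:R^-1 *: \sum_k q (f k)) +
     ((1 - e) / e) *: ((z *m A - c - q i) - (X k0 *m A - c - q i))); last first.
    rewrite /L /b' mulmxDl -scalemxAl mulmxBl.
    by apply/rowP => j; rewrite !mxE; ring.
  apply: le_trans (ler_normD _ _) _.
  have h1 : `|(z *m A - c - q i) - (X k0 *m A - c - q i)| <= 2 * s.
    by apply: le_trans (ler_normB _ _) _; move: hz hk0; rewrite /cell/=; lra.
  rewrite normrZ ger0_norm; last by rewrite divr_ge0// ?subr_ge0 ltW.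
  have h2 : (1 - e) / e * `|(z *m A - c - q i) - (X k0 *m A - c - q i)| <= (1 - e) / e * (2 * s).
    by rewrite ler_wpM2l// divr_ge0// ?subr_ge0 ltW.
  have h3 : s + (1 - e) / e * (2 * s) <= 3 * s / e.
    have -> : s + (1 - e) / e * (2 * s) = (s * e + (1 - e) * (2 * s)) / e.
      by field; rewrite gt_eqF.
    by rewrite ler_pM2r ?invr_gt0//; nra.
  by move: hb; rewrite /cell/=; lra.
have [w [w0 w1 hw]] := @simplex_contains R n s (3 * s / e) r (fun k => q (f k))
  (fun k => L (X (g k))) (L b') r0 s0 hf (fun k => (hg k).2) hs hb' hr.
have b'E : b' = \sum_k w k *: X (g k).
  have : b' *m A = (\sum_k w k *: X (g k)) *m A.
    apply: (addIr (- c)); rewrite [LHS]hw mulmx_suml.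
    under eq_bigr do rewrite scalerBr.
    rewrite sumrB -scaler_suml w1 scale1r; congr (_ - _).
    by apply: eq_bigr => k _; rewrite scalemxAl.
  by move=> /(congr1 (fun x => x *m invmx A)); rewrite !mulmxK.
rewrite xE.
have hb'' : hullN N X b'.
  by rewrite b'E; apply: hullN_convex => // k; apply: hullN_vertex; case: (hg k).
have := @hullN_convex R n N 2 X (fun i => if i == ord0 then 1 - e else e)
  (fun i => if i == ord0 then X k0 else b').
rewrite !big_ord_recl !big_ord0/= !addr0; apply.
- by move=> j; case: ifP => _; rewrite ?subr_ge0 ltW.
- by rewrite subrK.
- by move=> j; case: ifP => _ //; exact: hullN_vertex.
Qed.

End cells.

Lemma grid_cover (R : realType) (m : nat) (y : R) : (0 < m)%N -> `|y| <= 4 ->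
  exists k : 'I_m, `|y - ((2 * k + 1)%:R * (4 / m%:R) - 4)| <= 4 / m%:R.
Proof.
move=> m0; rewrite ler_norml => /andP[y1 y2].
have mR : 0 < m%:R :> R by rewrite ltr0n.
have sR : 0 < 4 / m%:R :> R by rewrite divr_gt0.
have msE : m%:R * (4 / m%:R) = 4 :> R by rewrite mulrC divfK// gt_eqF.
set s := 4 / m%:R in sR msE *.
pose t := (y + 4) / (2 * s).
have t0 : 0 <= t by rewrite divr_ge0//; [lra|rewrite mulr_ge0 ?ltW].
have tE : t * (2 * s) = y + 4 by rewrite divfK// gt_eqF// mulr_gt0.
have /andP[k1 k2] := truncn_itv t0.
have [km|km] := ltnP (Num.truncn t) m.
  exists (Ordinal km) => /=; rewrite natrD natrM.
  move: k2; rewrite -natr1 => k2.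
  rewrite ler_norml; apply/andP; split; nra.
(* Only the endpoint [y = 4] gets here; it belongs to the last interval. *)
have pm : (m.-1 < m)%N by rewrite prednK.
exists (Ordinal pm) => /=; rewrite natrD natrM.
have mE : m%:R = m.-1%:R + 1 :> R by rewrite natr1 prednK.
have : m%:R <= t by apply: le_trans k1; rewrite ler_nat.
rewrite mE in msE *; move=> h.
rewrite ler_norml; apply/andP; split; nra.
Qed.

(** * Lower bound *)

Lemma compact_finite_union (T : topologicalType) (I : finType) (H : {set I})
  (C : I -> set T) : (forall i, compact (C i)) ->
  compact [set x | exists2 i, i \in H & C i x].
Proof.
move=> cC; rewrite (_ : [set _ | _] = \big[setU/set0]_(i in H) C i).
  by elim/big_ind : _ => //; [exact: compact0|exact: compactU].
apply/seteqP; split => x; first by move=> [i iH Ci]; rewrite (bigD1 i)//=; left.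
elim/big_ind : _ => //= [A B hA hB [/hA|/hB]//|i iH Ci].
by exists i.
Qed.

Section lower_bound.
Context {R : realType} {n : nat} (mu : probability (Rn R n) R).
Hypothesis lc : log_concave mu.
Local Notation P A := (fine (mu A)).
Implicit Types (a x y q : 'rV[R]_n).

Lemma affine_slab (A : 'M[R]_n) (c a : 'rV[R]_n) (b r : R) :
  [set x : 'rV[R]_n | `|dot a (x *m A - c) - b| <= r] = slab (a *m A^T) (b + dot a c) r.
Proof.
by apply/seteqP; split => x; rewrite /slab/= -dot_mulmx trmxK dotDr dotNr;
  rewrite opprD [- b - _]addrC addrA.
Qed.

Lemma affine_coord (A : 'M[R]_n) (c x : 'rV[R]_n) j :
  (x *m A - c) ord0 j = dot (row j A^T) x - c ord0 j.
Proof.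
by rewrite !mxE; congr (_ - _); apply: eq_bigr => i _; rewrite !mxE mulrC.
Qed.

(** Borell's lemma with [r = 1] in each coordinate: a slab missing mass at most [p] leaves at most
    [p ^ 2 / (1 - p) <= 2 * p ^ 2] at distance 4 or more. *)
Lemma box_mass (A : 'M[R]_n) (c : 'rV[R]_n) (p : R) : 0 < p -> p <= 8^-1 ->
  (forall j, 1 - p <= P [set x : 'rV[R]_n | `|(x *m A - c) ord0 j| <= 1]) ->
  measurable ([set x : 'rV[R]_n | `|x *m A - c| <= 4] : set (Rn R n)) ->
  1 - 2 * n%:R * p ^+ 2 <= P [set x : 'rV[R]_n | `|x *m A - c| <= 4].
Proof.
move=> p0 p8 hp mB.
pose F j := [set x | 4 * 1 <= `|dot (row j A^T) x - c ord0 j|].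
have mF j : measurable (F j : set (Rn R n)).
  apply: measurable_closed_Rn.
  by apply: (@closed_dist_dot _ _ [set t | 4 * 1 <= t]); exact: closed_ge.
have hF j : P (F j) <= 2 * p ^+ 2.
  have := @prob_slab_borell R n mu lc (row j A^T) (c ord0 j) 1 ltr01.
  have := hp j.
  rewrite [X in P X](_ : _ = slab (row j A^T) (c ord0 j) 1); last first.
    by apply/seteqP; split => x; rewrite /slab/= affine_coord.
  have := prob_le1 mu (measurable_slab (row j A^T) (c ord0 j) 1).
  have := prob_ge0 mu (F j); rewrite -/(F j) !expr2.
  by set u := P (F j); set v := P _; nra.
have : P (~` [set x : 'rV[R]_n | `|x *m A - c| <= 4]) <= \sum_(j < n) P (F j).
  apply: prob_le_sum => //; first exact: measurableC.
  move=> x /= hx; apply/not_exists2P => h; apply: hx; apply/rV_norm_leP => // j.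
  rewrite affine_coord leNgt; apply/negP => hj.
  by have [//|] := h j; apply; rewrite /F/= mulr1 ltW.
have : \sum_(j < n) P (F j) <= \sum_(j < n) 2 * p ^+ 2 by apply: ler_sum.
rewrite sumr_const card_ord -[_ *+ n]mulr_natl probC//; lra.
Qed.

(** Here [p] bounds the mass missed by a coordinate slab, [m] is the number of cells per side, [eta]
    the threshold for heavy cells and [e] the weight of the centroid cell. The numerical conditions
    say that the heavy cells miss at most [p], that cells are small compared with the slabs, and
    that the simplex is fat enough for [hull_contains]. *)
Lemma expected_hull_mass_ge (p eta e : R) (m : nat) :
  (0 < n)%N -> (0 < m)%N -> 0 < p -> p <= 8^-1 -> 0 < eta -> eta <= 1 -> 0 < e < 1 ->
  2 * n%:R * p ^+ 2 + m%:R ^+ n * eta <= p ->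
  16 * n%:R ^+ 2 * (4 / m%:R) <= 1 :> R ->
  n%:R * (3 * (4 / m%:R) / e + 4 / m%:R) * (8 * n%:R) * (n%:R * n.+1%:R) <= 1 ->
  forall N : nat, m%:R ^+ n * (1 - eta) ^+ N <= 1 ->
  (((1 - (2 * n%:R * p ^+ 2 + m%:R ^+ n * eta)) `^ (1 - e) * eta `^ e *
    (1 - m%:R ^+ n * (1 - eta) ^+ N))%:E <= expected_hull_mass mu N)%E.
Proof.
move=> n0 m0 p0 p8 eta0 eta1 e01 hg hs1 hs2 N hN.
have nR : 1 <= n%:R :> R by rewrite ler1n.
have mR : 0 < m%:R :> R by rewrite ltr0n.
set g := 2 * n%:R * p ^+ 2 + m%:R ^+ n * eta in hg *.
have [A [c [uA hbox hslab]]] := log_concave_position lc p0 p8.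
set s : R := 4 / m%:R in hs1 hs2 *.
have s0 : 0 < s by rewrite divr_gt0.
pose q (i : {ffun 'I_n -> 'I_m}) : 'rV[R]_n := \row_j ((2 * i j + 1)%:R * s - 4).
pose C i := cell A c s (q i).
have cC i : compact (C i) by exact: cell_compact.
have mC i : measurable (C i : set (Rn R n)) by exact: measurable_cell.
pose H := [set i | eta <= P (C i)]%SET.
pose G := [set x | exists2 i, i \in H & C i x].
have cG : compact G by exact: compact_finite_union.
have mG : measurable (G : set (Rn R n)) by exact: measurable_compact_Rn.
have mB : measurable ([set x : 'rV[R]_n | `|x *m A - c| <= 4] : set (Rn R n)).
  rewrite (_ : [set _ | _] = cell A c 4 0); first exact: measurable_cell.
  by apply/seteqP; split => x; rewrite /cell/= subr0.
(* What [G] misses is outside the cube or in one of at most [m ^ n] light cells. *)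
have PG : 1 - g <= P G.
  have h1 := box_mass p0 p8 hbox mB.
  pose H' := (~: H)%SET; pose D := [set x | exists2 i, i \in H' & C i x].
  have cD : compact (D : set 'rV[R]_n) by exact: compact_finite_union.
  have h2 : P [set x : 'rV[R]_n | `|x *m A - c| <= 4] <= P G + P D.
    apply: prob_leU => //; first exact: measurable_compact_Rn.
    move=> x /= hx.
    have [f hf] : exists f : 'I_n -> 'I_m, forall j,
        `|(x *m A - c) ord0 j - ((2 * f j + 1)%:R * s - 4)| <= s.
      suff /choice[f hf] : forall j, exists k : 'I_m, `|(x *m A - c)
        ord0 j - ((2 * k + 1)%:R * s - 4)| <= s.
        by exists f.
      by move=> j; apply: grid_cover => //; apply: le_trans (rV_norm_coord _ _) hx.
    have Cx : C [ffun j => f j] x.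
      rewrite /C/cell/=; apply/rV_norm_leP => [|j]; first exact: ltW.
      by have := hf j; rewrite !mxE ffunE.
    by have [iH|iH] := boolP ([ffun j => f j] \in H); [left|right];
      exists [ffun j => f j] => //; rewrite inE.
  have h3 : P D <= \sum_(i in H') P (C i).
    by apply: prob_le_sum => //; exact: measurable_compact_Rn.
  have h4 : \sum_(i in H') P (C i) <= m%:R ^+ n * eta.
    apply: (@le_trans _ _ (\sum_(i : {ffun 'I_n -> 'I_m}) eta)).
      rewrite big_mkcond/=; apply: ler_sum => i _; case: ifP => [|_]; last exact: ltW.
      by rewrite !inE -ltNge => /ltW.
    by rewrite sumr_const card_ffun !card_ord -[_ *+ _]mulr_natl natrX.
  by rewrite /g; lra.
(* If the heavy centres lay in a slab of half-width 1/4, [G] would lie in one of half-width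
   [1/4 + 1/16 <= 1/3], whose mass is less than [1 - p]. *)
have sep a b : `|a| = 1 -> exists2 i, i \in H & 4^-1 < `|dot a (q i) - b|.
  move=> a1; apply/not_exists2P => h.
  have := hslab a b a1; apply/negP; rewrite -leNgt.
  apply: (@le_trans _ _ (P G)); first lra.
  apply: prob_le => //; first by rewrite affine_slab; exact: measurable_slab.
  move=> x [i iH hx] /=.
  have [//|/negP] := h i; rewrite -leNgt => hi.
  have -> : dot a (x *m A - c) - b = dot a (x *m A - c - q i) + (dot a (q i) - b).
    by rewrite [dot a (_ - q i)]dotDr dotNr addrA subrK.
  apply: le_trans (ler_normD _ _) _.
  have : `|dot a (x *m A - c - q i)| <= n%:R * s.
    apply: le_trans (dot_norm _ _) _; rewrite a1 mulr1 ler_wpM2l//.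
  have : 16 * (n%:R * s) <= 1.
    apply: le_trans hs1; rewrite -mulrA ler_pM2l// expr2 -mulrA ler_peMl// mulr_ge0// ltW//.
  lra.
have q0 : 0 < 4^-1 :> R by [].
have [f fH hf] := exists_simplex n0 q0 sep.
pose cb : 'rV[R]_n := n.+1%:R^-1 *: \sum_k q (f k).
have cbm : eta <= P (cell A c s cb).
  by apply: cell_mean_mass => // k; have := fH k; rewrite inE.
pose T := mink_comb (1 - e) G (cell A c s cb).
have cT : compact T by apply: mink_comb_compact => //; exact: cell_compact.
have mT := measurable_compact_Rn cT.
have e0 : 0 < e by case/andP: e01.
have e1 : e < 1 by case/andP: e01.
have PT : (1 - g) `^ (1 - e) * eta `^ e <= P T.
  have h := lc.1 G (cell A c s cb) (1 - e) cG (@cell_compact _ _ _ _ _ uA cb).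
  apply: le_trans (h _); last by lra.
  rewrite (_ : 1 - (1 - e) = e); last by lra.
  have g1 : 0 <= 1 - g by rewrite subr_ge0 (le_trans hg)// (le_trans p8)// invf_le1// ler1n.
  have e2 : 0 <= 1 - e by rewrite subr_ge0 ltW.
  by apply: ler_pM; rewrite ?powR_ge0//; apply: ge0_ler_powR;
    rewrite ?nnegrE ?prob_ge0 ?(ltW e0) ?(ltW eta0).
rewrite /expected_hull_mass.
(* When all heavy cells are hit the hull contains [T]; otherwise its mass is bounded below by 0. *)
pose F (x : nat -> 'rV[R]_n) : \bar R := if `[< hit_all C N H x >] then (P T)%:E else 0%E.
apply: (@le_trans _ _ (iter_expect mu N F)); rewrite /F; last first.
  apply: le_iter_expect => x; first by case: ifP; rewrite // lee_fin prob_ge0.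
  case: asboolP => // hx; rewrite prob_fineK// le_measure ?inE//.
    by apply: measurable_compact_Rn; exact: hullN_compact.
  apply: (@hull_contains R n A c s uA _ H q f (4^-1 / n%:R) e) => //.
  - by rewrite divr_gt0// (lt_le_trans ltr01).
  - exact: ltW.
  - rewrite ler_pdivlMr ?(lt_le_trans ltr01)//.
    by move: hs1; rewrite expr2; lra.
  - move: hs2; congr (_ <= 1); congr (_ * _ * _).
    by field; rewrite gt_eqF// (lt_le_trans ltr01).
apply: le_trans (iter_expect_hit_all mu mC N H (prob_ge0 mu T)).
rewrite lee_fin; apply: ler_pM => //.
- by rewrite mulr_ge0 ?powR_ge0.
- by rewrite subr_ge0.
rewrite lerD2l lerN2.
apply: (@le_trans _ _ (\sum_(i : {ffun 'I_n -> 'I_m}) (1 - eta) ^+ N)).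
  rewrite big_mkcond/=; apply: ler_sum => i _; case: ifP => [|_];
    last by rewrite exprn_ge0// subr_ge0.
  rewrite inE => hi; apply: lerXn2r; rewrite ?nnegrE ?subr_ge0//; last by rewrite lerD2l lerN2.
  exact: prob_le1.
by rewrite sumr_const card_ffun !card_ord -[_ *+ _]mulr_natl natrX.
Qed.

End lower_bound.

(** * Choice of the parameters *)

Section final_estimate.
Context {R : realType}.

(** The induction rests on [(1 - eta) * (1 + (N + 1) * eta) <= 1 + N * eta]. The result bounds the
    probability that [N] points miss a cell of mass [eta]. *)
Lemma bernoulli_inv (eta : R) (N : nat) : 0 < eta -> eta <= 1 ->
  (1 - eta) ^+ N * (N%:R * eta) <= 1.
Proof.
move=> e0 e1; apply: (@le_trans _ _ ((1 - eta) ^+ N * (1 + N%:R * eta))).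
  by rewrite ler_wpM2l ?exprn_ge0 ?subr_ge0// lerDr.
elim: N => [|N IH]; first by rewrite expr0 mul0r; lra.
apply: le_trans IH; rewrite exprS -natr1 mulrAC mulrC.
rewrite ler_wpM2l ?exprn_ge0 ?subr_ge0//.
have : 0 <= N%:R * (eta * eta) by rewrite !mulr_ge0// ltW.
have : 0 <= eta * eta by rewrite mulr_ge0// ltW.
nra.
Qed.

Lemma mulr3_ge (a b c x y z : R) : 0 <= a <= 1 -> 0 <= b <= 1 -> 0 <= c <= 1 ->
  1 - a <= x -> 1 - b <= y -> 1 - c <= z -> 1 - (a + b + c) <= x * y * z.
Proof.
move=> /andP[a0 a1] /andP[b0 b1] /andP[c0 c1] ax bx cx.
apply: (@le_trans _ _ ((1 - a) * (1 - b) * (1 - c))).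
  have : 0 <= a * b by rewrite mulr_ge0.
  have : 0 <= (1 - c) * (a * b) by rewrite !mulr_ge0 ?subr_ge0.
  have : 0 <= c * (a + b) by rewrite mulr_ge0// addr_ge0.
  nra.
by rewrite !ler_pM ?mulr_ge0 ?subr_ge0.
Qed.

(** The fatness condition for [x ^ 9] cells per side, centroid weight [x ^ -3] and [k = n + 1]. The
    left side is at most [256 / x ^ 2], whence the threshold 16. *)
Lemma simplex_margin (x k : R) : 16 <= x -> 0 <= k <= 2 * x ->
  x * (4 / x ^+ 9 * (3 * x ^+ 3 + 1)) * (8 * x) * (x * k) <= 1.
Proof.
move=> x16 /andP[k0 kx].
have x0 : 0 < x by lra.
have x3 : 1 <= x ^+ 3 by rewrite exprn_ege1//; lra.
have x9 : 0 <= 4 / x ^+ 9 by rewrite divr_ge0// exprn_ge0// ltW.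
apply: (@le_trans _ _ (x * (4 / x ^+ 9 * (4 * x ^+ 3)) * (8 * x) * (x * (2 * x)))).
  apply: ler_pM.
  - by rewrite !mulr_ge0//; lra.
  - by rewrite mulr_ge0//; lra.
  - rewrite ler_wpM2r ?mulr_ge0//; [lra|].
    rewrite ler_wpM2l//; [lra|].
    rewrite ler_wpM2l//; lra.
  - by rewrite ler_wpM2l//; lra.
rewrite [leLHS](_ : _ = 256 / x ^+ 2); last by field; rewrite gt_eqF.
rewrite ler_pdivrMr ?exprn_gt0// mul1r expr2; nra.
Qed.

(** The three factors of the bound in [expected_hull_mass_ge] are at least [1 - 3 / n], [1 - 12 / n]
    and [1 - 1 / n]. *)
Lemma log_concave_lower_bound (n N : nat) (u : R) (mu : probability (Rn R n) R) :
  (16 <= n)%N -> 1 <= u -> log_concave mu ->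
  expR (22 * (n%:R * ln n%:R) ^+ 2 * u) <= N%:R ->
  ((1 - 16 / n%:R)%:E <= expected_hull_mass mu N)%E.
Proof.
move=> n16 u1 lc hN.
set x : R := n%:R in hN *.
have x16 : 16 <= x by rewrite /x ler_nat.
have x0 : 0 < x by lra.
have xn0 : x != 0 by rewrite gt_eqF.
have lnx : 1 / 2 <= ln x.
  have y0 : -1 < x^-1 - 1 by rewrite ltrBrDr addNr invr_gt0.
  have := le_ln1Dx y0; rewrite addrC subrK.
  rewrite lnV ?posrE// => h.
  have : x^-1 <= 16^-1 by rewrite lef_pV2 ?posrE.
  lra.
have lnxx : ln x <= x.
  have y1 : -1 < x - 1 by lra.
  by have := le_ln1Dx y1; rewrite addrC subrK; lra.
have xl : 1 <= x * ln x by apply: (@le_trans _ _ (16 * (1 / 2))); [lra|apply: ler_pM; lra].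
(* [M] is the number of cells; with [eta] as below the light cells weigh at most [M * eta = x ^ -3]
   in total. *)
pose M := x ^+ (9 * n).
have M0 : 0 < M by rewrite exprn_gt0.
pose eta := (x ^+ 3 * M)^-1.
have x3 : 0 < x ^+ 3 by rewrite exprn_gt0.
have eta0 : 0 < eta by rewrite invr_gt0 mulr_gt0.
have M1 : 1 <= M by rewrite exprn_ege1//; lra.
have x31 : 1 <= x ^+ 3 by rewrite exprn_ege1//; lra.
have eta1 : eta <= 1.
  by rewrite invf_le1 ?mulr_gt0// -[leLHS]mulr1 ler_pM.
have mE : (n ^ 9)%:R ^+ n = M by rewrite natrX -exprM.
have Meta : M * eta = x^-1 ^+ 3.
  by rewrite /eta invfM mulrCA divff ?gt_eqF// mulr1 exprVn.
pose p := x^-1 ^+ 2; pose e := x^-1 ^+ 3.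
have y0 : 0 < x^-1 by rewrite invr_gt0.
have y16 : x^-1 <= 16^-1 by rewrite lef_pV2 ?posrE.
have yx : x^-1 * x = 1 by rewrite mulVf.
have [a3 a12 a1] : [/\ 0 <= 3 * x^-1 <= 1, 0 <= 12 * x^-1 <= 1 & 0 <= x^-1 <= 1] by split; lra.
have gE : 2 * x * p ^+ 2 + (n ^ 9)%:R ^+ n * eta = 3 * x^-1 ^+ 3.
  by rewrite mE Meta /p; field.
have hNM : M * (1 - eta) ^+ N <= x^-1.
  have h1 := bernoulli_inv N eta0 eta1.
  (* Since [x * ln x >= 1] and [u >= 1], the given exponent is at least [22 * x * ln x], and
     [18 * n + 4 <= 22 * n]. The power [x ^ (18 * n + 4)] is [x * M / eta], which makes the expected
     number of missed heavy cells at most [1 / x]. *)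
  have Nbig : x ^+ (18 * n + 4) <= N%:R.
    apply: le_trans hN; rewrite -[x ^+ _](lnK (_ : _ \is Num.pos)) ?posrE ?exprn_gt0//.
    rewrite ler_expR lnXn//.
    apply: (@le_trans _ _ (22 * (x * ln x))).
      by rewrite -[leLHS]mulr_natl natrD natrM -/x mulrA ler_wpM2r; lra.
    rewrite -mulrA ler_pM2l// expr2 -mulrA ler_peMr; [by []|lra|].
    by rewrite -[1]mulr1 ler_pM.
  have NE : x * M / eta <= N%:R.
    apply: le_trans Nbig; rewrite /eta invrK /M.
    rewrite (_ : (18 * n + 4 = 1 + 9 * n + (3 + 9 * n))%N); last by ring.
    by rewrite !exprD expr1 mulrA.
  have Neta : x * M <= N%:R * eta by rewrite -ler_pdivrMr.
  rewrite -[leRHS]mul1r ler_pdivlMr//.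
  apply: le_trans h1; rewrite mulrC mulrA mulrC ler_wpM2l// exprn_ge0// subr_ge0//.
have p8 : p <= 8^-1 by rewrite /p expr2; nra.
have p0 : 0 < p by rewrite exprn_gt0.
have e0 : 0 < e by rewrite exprn_gt0.
have e1 : e < 1.
  rewrite /e exprS -(mulr1 1) ltr_pM//; [exact: ltW|exact: exprn_ge0 (ltW y0)|lra|].
  by rewrite expr2; nra.
have n0 : (0 < n)%N by rewrite (leq_trans _ n16).
have m0 : (0 < n ^ 9)%N by rewrite expn_gt0 n0.
have := @expected_hull_mass_ge R n mu lc p eta e (n ^ 9) n0 m0 p0 p8 eta0 eta1.
rewrite e0 e1 -/x gE => /(_ isT) h.
have {}h := h _ _ _ N _.
have c1 : 3 * x^-1 ^+ 3 <= p.
  rewrite /p exprS mulrA -[leRHS]mul1r ler_wpM2r ?exprn_ge0 ?(ltW y0)//; lra.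
have c2 : 16 * x ^+ 2 * (4 / (n ^ 9)%:R) <= 1.
  rewrite natrX -/x mulrA ler_pdivrMr ?exprn_gt0// mul1r.
  rewrite (exprD x 2 7) -mulrA mulrCA ler_pM2l ?exprn_gt0//.
  apply: (@le_trans _ _ (x ^+ 2)); first by rewrite expr2; nra.
  by rewrite ler_weXn2l//; lra.
have c3 : x * (3 * (4 / (n ^ 9)%:R) / e + 4 / (n ^ 9)%:R) * (8 * x) * (x * n.+1%:R) <= 1.
  have -> : 3 * (4 / (n ^ 9)%:R) / e + 4 / (n ^ 9)%:R = 4 / x ^+ 9 * (3 * x ^+ 3 + 1).
    by rewrite natrX -/x /e; field.
  by apply: simplex_margin; rewrite // -natr1 -/x; lra.
have c4 : (n ^ 9)%:R ^+ n * (1 - eta) ^+ N <= 1 by rewrite mE; apply: le_trans hNM _; lra.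
apply: le_trans (h c1 c2 c3 c4); rewrite lee_fin mE.
have -> : 1 - 16 / x = 1 - (3 * x^-1 + 12 * x^-1 + x^-1) by field.
apply: mulr3_ge => //; last by rewrite lerD2l lerN2.
- have y2 : x^-1 ^+ 3 <= x^-1.
    rewrite exprS ler_piMr ?(ltW y0)// expr2; nra.
  apply: (@le_trans _ _ (1 - 3 * x^-1 ^+ 3)); first lra.
  have g0 : 0 < 1 - 3 * x^-1 ^+ 3 by lra.
  have g1 : 1 - 3 * x^-1 ^+ 3 <= 1 by have := exprn_ge0 3 (ltW y0); lra.
  rewrite -[leLHS]powRr1 ?(ltW g0)//.
  apply: ger_powR; [by apply/andP; split|lra].
(* By [exp y >= 1 + y] it suffices that [e * ln (1 / eta) = x ^ -3 * (9 * n + 3) * ln x] is at most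
   [12 / x]. *)
- rewrite /powR gt_eqF//; apply: le_trans (expR_ge1Dx _).
  rewrite lerD2l /eta lnV ?posrE ?mulr_gt0// mulrN lerN2 -exprD lnXn// -[ln x *+ _]mulr_natl.
  have -> : 12 * x^-1 = e * (12 * x * x) by rewrite /e; field.
  rewrite ler_pM2l//; apply: ler_pM => //; first by lra.
  by rewrite natrD natrM -/x; lra.
Qed.

End final_estimate.

(** * The one-dimensional Prekopa-Leindler inequality *)

Section one_dimensional_brunn_minkowski.
Context {R : realType}.
Local Notation leb := (@lebesgue_measure R).
Implicit Types (D E Z : set R).

Lemma measurable_affine_preimage (k c : R) (A : set (measurableTypeR R)) :
  measurable A -> measurable ([set t : R | A ((t - c) / k)] : set (measurableTypeR R)).
Proof.
move=> mA.
have mg : measurable_fun setT (fun t : measurableTypeR R => (t - c) / k : measurableTypeR R).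
  by apply: measurable_funM => //; exact: measurable_funB.
by rewrite -[X in measurable X]setTI; exact: mg.
Qed.

(** By uniqueness of Lebesgue measure: the pushforward under the affine map, divided by [k], gives
    half-open intervals their length. *)
Lemma lebesgue_measure_affine (k c : R) (A : set (measurableTypeR R)) :
  0 < k -> measurable A ->
  leb [set t | A ((t - c) / k)] = (k%:E * leb A)%E.
Proof.
move=> k0 mA; pose g (t : measurableTypeR R) : measurableTypeR R := (t - c) / k.
have mg : measurable_fun setT g.
  by apply: measurable_funM => //; exact: measurable_funB.
have ki0 : 0 <= k^-1 by rewrite invr_ge0 ltW.
have := @lebesgue_measure_unique R (mscale (NngNum ki0) (pushforward leb g)) _ A mA.
move=> -> /=.
  by rewrite /mscale/= muleA -EFinM divff ?gt_eqF// mul1e.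
move=> _ [[a b] _ <-]; rewrite /mscale/= /pushforward.
rewrite (_ : g @^-1` `]a, b]%classic = `]k * a + c, k * b + c]%classic).
  rewrite !lebesgue_measure_itv/= !lte_fin ltrD2r ltr_pM2l//.
  case: ifPn => _; last by rewrite mule0.
  by rewrite -!EFinB -EFinM; congr _%:E; field; rewrite gt_eqF.
apply/seteqP; split => t; rewrite /g/= !in_itv/= ltr_pdivlMr// ler_pdivrMr//;
  rewrite [k * a]mulrC [k * b]mulrC => /andP[h1 h2]; apply/andP; split; lra.
Qed.

(** Take [d] in [D] near its supremum and [f] in [E] near its infimum. After cutting [D] above [d]
    and [E] below [f], the copies [l * D + (1 - l) * f] and [l * d + (1 - l) * E] lie in [Z], on the
    two sides of [q = l * d + (1 - l) * f]. *)
Lemma brunn_minkowski1 D E Z (l : R) : 0 < l < 1 ->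
  measurable (D : set (measurableTypeR R)) -> measurable (E : set (measurableTypeR R)) ->
  measurable (Z : set (measurableTypeR R)) ->
  D !=set0 -> E !=set0 -> has_ubound D -> has_lbound E ->
  (forall s t, D s -> E t -> Z (l * s + (1 - l) * t)) ->
  (l%:E * leb D + (1 - l)%:E * leb E <= leb Z)%E.
Proof.
move=> /andP[l0 l1] mD mE mZ D0 E0 bD bE DEZ.
have k0 : 0 < 1 - l by lra.
apply/lee_addgt0Pr => e e0.
have sD : has_sup D by [].
have iE : has_inf E by [].
have [d Dd hd] := sup_adherent e0 sD.
have [f Ef hf] := inf_adherent e0 iE.
pose D1 := D `&` `]-oo, d]%classic; pose E1 := E `&` `[f, +oo[%classic.
have mD1 : measurable (D1 : set (measurableTypeR R)) by exact: measurableI.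
have mE1 : measurable (E1 : set (measurableTypeR R)) by exact: measurableI.
have hD : (leb D <= leb D1 + e%:E)%E.
  apply: (@le_trans _ _ (leb (D1 `|` `]d, sup D]%classic))).
    rewrite le_measure// ?inE//; first exact: measurableU.
    move=> t Dt; have [td|td] := leP t d; [left; split => //|right] => /=.
    by rewrite in_itv/= td/=; exact: sup_upper_bound.
  apply: le_trans (measureU2 _ _ _) _ => //.
  rewrite /= leeD2l// lebesgue_measure_itv/= lte_fin.
  case: ifPn => _; last by rewrite lee_fin ltW.
  rewrite -EFinB lee_fin; lra.
have hE : (leb E <= leb E1 + e%:E)%E.
  apply: (@le_trans _ _ (leb (E1 `|` `[inf E, f[%classic))).
    rewrite le_measure// ?inE//; first exact: measurableU.
    move=> t Et; have [tf|tf] := leP f t; [left; split => //|right] => /=.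
      by rewrite in_itv/= tf.
    by rewrite in_itv/= tf andbT; exact: ge_inf.
  apply: le_trans (measureU2 _ _ _) _ => //.
  rewrite /= leeD2l// lebesgue_measure_itv/= lte_fin.
  case: ifPn => _; last by rewrite lee_fin ltW.
  rewrite -EFinB lee_fin; lra.
pose S1 := [set t | D1 ((t - (1 - l) * f) / l)].
pose S2 := [set t | E1 ((t - l * d) / (1 - l))].
have mS1 : measurable (S1 : set (measurableTypeR R)) by exact: measurable_affine_preimage.
have mS2 : measurable (S2 : set (measurableTypeR R)) by exact: measurable_affine_preimage.
pose q := l * d + (1 - l) * f.
have S1q t : S1 t -> t <= q.
  by move=> [_] /=; rewrite in_itv/= ler_pdivrMr// /q; lra.
have S2q t : S2 t -> q <= t.
  by move=> [_] /=; rewrite in_itv/= andbT ler_pdivlMr// /q; lra.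
have hS : (leb S1 + leb S2 <= leb Z)%E.
  (* Removing the possible common point [q] makes the copies disjoint without changing the
     measure. *)
  apply: (@le_trans _ _ (leb (S1 `\ q) + leb S2)%E).
    rewrite leeD2r//; apply: (@le_trans _ _ (leb ((S1 `\ q) `|` [set q]))).
      rewrite le_measure// ?inE//; first by apply: measurableU => //; exact: measurableD.
      by move=> t St; have [->|/eqP tq] := eqVneq t q; [right|left; split].
    apply: le_trans (measureU2 _ _ _) _ => //; first exact: measurableD.
    by rewrite /= lebesgue_measure_set1 adde0.
  rewrite -measureU//; last 2 first.
  - exact: measurableD.
  - apply/seteqP; split => // t [[/S1q tq tnq] /S2q qt]; apply: tnq.
    by apply/eqP; rewrite eq_le tq qt.
  rewrite le_measure// ?inE//; first by apply: measurableU => //; exact: measurableD.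
  move=> t [[[Dt _] _]|[Et _]].
    rewrite (_ : t = l * ((t - (1 - l) * f) / l) + (1 - l) * f); first exact: DEZ.
    by field; rewrite gt_eqF.
  rewrite (_ : t = l * d + (1 - l) * ((t - l * d) / (1 - l))); first exact: DEZ.
  by field; rewrite gt_eqF.
apply: (@le_trans _ _ (l%:E * (leb D1 + e%:E) + (1 - l)%:E * (leb E1 + e%:E))%E).
  by apply: leeD; apply: lee_wpmul2l => //; rewrite lee_fin ltW.
rewrite !muleDr ?fin_num_adde_defl//.
rewrite addeACA.
have -> : (l%:E * e%:E + (1 - l)%:E * e%:E = e%:E)%E by rewrite -!EFinM -EFinD; congr _%:E; ring.
rewrite leeD2r//.
by move: hS; rewrite /S1 /S2 !lebesgue_measure_affine.
Qed.

(** Young's inequality with the conjugate exponents [1 / l] and [1 / (1 - l)]. *)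
Lemma weighted_am_gm (a b l : R) : 0 <= a -> 0 <= b -> 0 < l < 1 ->
  a `^ l * b `^ (1 - l) <= l * a + (1 - l) * b.
Proof.
move=> a0 b0 /andP[l0 l1]; have k0 : 0 < 1 - l by lra.
have := @conjugate_powR R (a `^ l) (b `^ (1 - l)) l^-1 (1 - l)^-1.
rewrite !powR_ge0 !invr_gt0 !invrK => /(_ isT isT l0 k0).
rewrite -!powRrM !divff ?gt_eqF// !powRr1// => h.
by apply: le_trans (h _) _; [lra|rewrite mulrC [b * _]mulrC].
Qed.

End one_dimensional_brunn_minkowski.

Section prekopa_leindler.
Context {R : realType}.
Local Notation leb := (@lebesgue_measure R).

Definition unif : probability (measurableTypeR R) R := uniform_prob (@ltr01 R).

Lemma unifE (A : set (measurableTypeR R)) : measurable A ->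
  unif A = leb (A `&` `[0, 1]%classic).
Proof.
move=> mA; rewrite /unif/= /uniform_prob integral_uniform_pdf.
rewrite (eq_integral (fun=> 1%:E)).
  by rewrite integral_cst ?mul1e//; exact: measurableI.
by move=> x; rewrite inE => -[_] /=; rewrite in_itv/= /uniform_pdf => ->; rewrite subr0 invr1.
Qed.

(** By the layer-cake formula it suffices to compare superlevel sets, where [brunn_minkowski1]
    applies. Normalizing both suprema to 1 makes the sets of [X] and [Y] nonempty for the same
    levels [r < 1]. *)
Lemma prekopa_leindler_normalized (X Y Z : {RV unif >-> R}) (l : R) : 0 < l < 1 ->
  (forall t, 0 <= X t <= 1) -> (forall t, 0 <= Y t <= 1) -> (forall t, 0 <= Z t) ->
  (forall r, r < 1 -> exists2 t, 0 <= t <= 1 & r < X t) ->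
  (forall r, r < 1 -> exists2 t, 0 <= t <= 1 & r < Y t) ->
  (forall s t, 0 <= s <= 1 -> 0 <= t <= 1 ->
     X s `^ l * Y t `^ (1 - l) <= Z (l * s + (1 - l) * t)) ->
  (l%:E * 'E_unif[X] + (1 - l)%:E * 'E_unif[Y] <= 'E_unif[Z])%E.
Proof.
move=> l01 X01 Y01 Z0 supX supY XYZ.
have /andP[l0 l1] := l01; have k0 : 0 < 1 - l by lra.
rewrite !ge0_expectation_ccdf//; last 2 first.
- by move=> t; case/andP: (Y01 t).
- by move=> t; case/andP: (X01 t).
have mcc (W : {RV unif >-> R}) (D : set R) : measurable_fun D (ccdf W).
  by apply: measurable_funTS; exact: ccdf_measurable.
rewrite -!ge0_integralZl//; try exact: mcc; try by rewrite lee_fin ltW.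
rewrite -ge0_integralD//; last 4 first.
- by move=> r _; rewrite mule_ge0// lee_fin ltW.
- by apply: emeasurable_funM => //; exact: mcc.
- by move=> r _; rewrite mule_ge0// lee_fin ltW.
- by apply: emeasurable_funM => //; exact: mcc.
apply: ge0_le_integral => //.
- by move=> r _; rewrite adde_ge0// mule_ge0// lee_fin ltW.
- by apply: emeasurable_funD; apply: emeasurable_funM => //; exact: mcc.
- exact: mcc.
move=> r hr; have r0 : 0 <= r by move: hr; rewrite /= in_itv/= andbT.
have [r1|r1] := ltP r 1; last first.
  have cc0 (W : {RV unif >-> R}) : (forall t, 0 <= W t <= 1) -> ccdf W r = 0%E.
    move=> W01; rewrite /ccdf /distribution /pushforward.
    rewrite (_ : _ @^-1` _ = set0) ?measure0//; apply/seteqP; split => // t /=.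
    by rewrite in_itv/= andbT => /lt_le_trans/(_ (proj2 (andP (W01 t)))); rewrite ltNge r1.
  by rewrite (cc0 X)// (cc0 Y)// !mule0 adde0.
have mS (W : {RV unif >-> R}) : measurable (W @^-1` `]r, +oo[ : set (measurableTypeR R)).
  rewrite -[X in measurable X]setTI; exact: (measurable_funPT W).
rewrite /ccdf /distribution /pushforward !unifE//.
apply: brunn_minkowski1 => //.
- by apply: measurableI.
- by apply: measurableI.
- by apply: measurableI.
- by have [t t01 rt] := supX r r1; exists t; split; rewrite /= in_itv/= ?t01// andbT.
- by have [t t01 rt] := supY r r1; exists t; split; rewrite /= in_itv/= ?t01// andbT.
- by exists 1 => t [_] /=; rewrite in_itv/= => /andP[].
- by exists 0 => t [_] /=; rewrite in_itv/= => /andP[].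
move=> s t [] /= + + [] /=; rewrite !in_itv/= !andbT => rX s01 rY t01; split => /=; last first.
  by case/andP: s01 => ? ?; case/andP: t01 => ? ?; apply/andP; split; nra.
apply: lt_le_trans (XYZ s t s01 t01).
have [->|rn0] := eqVneq r 0.
  rewrite mulr_gt0// powR_gt0//.
    exact: le_lt_trans rX.
  exact: le_lt_trans rY.
have rp : 0 < r by rewrite lt_neqAle eq_sym rn0.
have -> : r = r `^ l * r `^ (1 - l).
  rewrite -powRD; last by rewrite (gt_eqF rp) implybT.
  by rewrite addrC subrK powRr1.
by apply: ltr_pM; rewrite ?powR_ge0//; apply: gt0_ltr_powR; rewrite ?nnegrE// ltW// (lt_trans rp).
Qed.

End prekopa_leindler.

Section prekopa_leindler_general.
Context {R : realType}.
Implicit Types f g h : measurableTypeR R -> R.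

Lemma integral_unif_eq f g : measurable_fun setT f -> measurable_fun setT g ->
  (forall t, 0 <= f t) -> (forall t, 0 <= g t) ->
  (forall t, 0 <= t <= 1 -> f t = g t) ->
  (\int[unif]_t (f t)%:E = \int[unif]_t (g t)%:E)%E.
Proof.
move=> mf mg f0 g0 fg; rewrite !integral_uniform//; last 2 first.
- exact/measurable_EFinP.
- exact/measurable_EFinP.
congr (_ * _)%E; apply: eq_integral => t; rewrite inE/= in_itv/= => t01.
by rewrite fg.
Qed.

Lemma integral_unif_fin_num f (K : R) : measurable_fun setT f ->
  (forall t, 0 <= f t <= K) -> (\int[unif]_t (f t)%:E)%E \is a fin_num.
Proof.
move=> mf fK; rewrite ge0_fin_numE; last first.
  by apply: integral_ge0 => t _; rewrite lee_fin; case/andP: (fK t).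
apply: (@le_lt_trans _ _ (\int[unif]_t K%:E)%E).
  apply: ge0_le_integral => //.
  - by move=> t _; rewrite lee_fin; case/andP: (fK t).
  - exact/measurable_EFinP.
  - by move=> t _; rewrite lee_fin; case/andP: (fK t).
by rewrite integral_cst//= probability_setT mule1 ltry.
Qed.

Lemma integral_unifZ f (k : R) : measurable_fun setT f -> 0 <= k ->
  (forall t, 0 <= f t) ->
  (\int[unif]_t (k * f t)%:E = k%:E * \int[unif]_t (f t)%:E)%E.
Proof.
move=> mf k0 f0; rewrite (eq_integral (fun t => k%:E * (f t)%:E)%E)//.
by rewrite ge0_integralZl//; [exact/measurable_EFinP|move=> t _; rewrite lee_fin].
Qed.

(** Dividing [f] and [g] by their suprema over the unit interval reduces to the normalized case,
    whose arithmetic mean dominates the geometric mean. *)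
Lemma prekopa_leindler f g h (l : R) : 0 < l < 1 ->
  measurable_fun setT f -> measurable_fun setT g -> measurable_fun setT h ->
  (forall t, 0 <= f t <= 1) -> (forall t, 0 <= g t <= 1) ->
  (forall t, 0 <= h t <= 1) ->
  (forall s t, f s `^ l * g t `^ (1 - l) <= h (l * s + (1 - l) * t)) ->
  fine (\int[unif]_t (f t)%:E)%E `^ l * fine (\int[unif]_t (g t)%:E)%E `^ (1 - l) <=
  fine (\int[unif]_t (h t)%:E)%E.
Proof.
move=> l01 mf mg mh f01 g01 h01 fgh.
have /andP[l0 l1] := l01; have k0 : 0 < 1 - l by lra.
pose I01 : set (measurableTypeR R) := `[0, 1]%classic.
(* If the supremum vanishes so does the integral, and the left side is then 0 because both exponents
   are positive. *)
have norml f' : measurable_fun setT f' -> (forall t, 0 <= f' t <= 1) ->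
    fine (\int[unif]_t (f' t)%:E)%E = 0 \/
    exists M (X : {RV unif >-> R}), [/\ 0 < M, (forall t, 0 <= X t <= 1),
      (forall r, r < 1 -> exists2 t, 0 <= t <= 1 & r < X t),
      (forall t, X t * M <= f' t) &
      (\int[unif]_t (f' t)%:E = M%:E * 'E_unif[X])%E].
  move=> mf' f'01; pose S := [set f' t | t in I01].
  have S0 : has_sup S.
    split; first by exists (f' 0), 0 => //=; rewrite /I01/= in_itv/= lexx ler01.
    by exists 1 => _ [t _ <-]; case/andP: (f'01 t).
  have fS t : 0 <= t <= 1 -> f' t <= sup S.
    by move=> t01; apply: (sup_upper_bound S0); exists t.
  have := fS 0; rewrite lexx ler01 => /(_ isT) fS0.
  have : 0 <= sup S by apply: le_trans fS0; case/andP: (f'01 0).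
  rewrite le_eqVlt => /predU1P[S00|S00].
    left; rewrite (@integral_unif_eq _ (cst 0))//=.
    - by rewrite integral0_eq.
    - by move=> t; case/andP: (f'01 t).
    - by move=> t /fS; rewrite -S00 => ?; apply/eqP; rewrite eq_le;
      case/andP: (f'01 t) => -> _; rewrite andbT.
  right; exists (sup S).
  (* The indicator removes values outside the unit interval, where [f'] may exceed its supremum over
     the interval. *)
  pose X0 (t : measurableTypeR R) : R := f' t * \1_I01 t / sup S.
  have mX0 : measurable_fun setT X0.
    apply: measurable_funM => //; apply: measurable_funM => //.
    by apply/measurable_indicP; exact: measurable_itv.
  pose X : {RV unif >-> R} := HB.pack X0 (isMeasurableFun.Build _ _ _ _ X0 mX0).
  have XE t : X t = X0 t by [].
  have X01 t : 0 <= X t <= 1.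
    rewrite XE /X0 indicE; have [tI|tI] := boolP (t \in I01); last first.
      by rewrite mulr0 mul0r lexx ler01.
    rewrite mulr1 divr_ge0 ?(ltW S00)//=; last by case/andP: (f'01 t).
    rewrite ler_pdivrMr// mul1r fS//.
    by move: tI; rewrite inE /I01/= in_itv.
  exists X; split => //.
  - move=> r r1; have e0 : 0 < (1 - r) * sup S by rewrite mulr_gt0// subr_gt0.
    have [_ [t It <-] hy] := sup_adherent e0 S0.
    exists t; first by move: It; rewrite /I01/= in_itv.
    rewrite XE /X0 indicE mem_set// mulr1 ltr_pdivlMr//.
    by move: hy; rewrite mulrBl mul1r opprB addrC subrK.
  - move=> t; rewrite XE /X0 divfK ?gt_eqF// indicE; case: (t \in I01); rewrite ?mulr1// mulr0.
    by case/andP: (f'01 t).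
  - rewrite expectation_def -integral_unifZ//; [|exact: ltW|by move=> t; case/andP: (X01 t)].
    apply: integral_unif_eq => //.
    + by apply: measurable_funM.
    + by move=> t; case/andP: (f'01 t).
    + by move=> t; rewrite mulr_ge0 ?(ltW S00)//; case/andP: (X01 t).
    move=> t t01; rewrite XE /X0 mulrC divfK ?gt_eqF// indicE mem_set ?mulr1//.
have hI0 : 0 <= fine (\int[unif]_t (h t)%:E)%E.
  by apply: fine_ge0; apply: integral_ge0 => t _; rewrite lee_fin; case/andP: (h01 t).
have [->|[Mf [X [Mf0 X01 supX Xf EX]]]] := norml f mf f01.
  by rewrite powR0 ?gt_eqF// mul0r.
have [->|[Mg [Y [Mg0 Y01 supY Yg EY]]]] := norml g mg g01.
  by rewrite [X in _ * X]powR0 ?gt_eqF// mulr0.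
pose M := Mf `^ l * Mg `^ (1 - l).
have M0 : 0 < M by rewrite mulr_gt0// powR_gt0.
pose Z0 (t : measurableTypeR R) : R := M^-1 * h t.
have mZ0 : measurable_fun setT Z0 by apply: measurable_funM.
pose Z : {RV unif >-> R} := HB.pack Z0 (isMeasurableFun.Build _ _ _ _ Z0 mZ0).
have h0 t : 0 <= h t by case/andP: (h01 t).
have H := @prekopa_leindler_normalized R X Y Z l l01 X01 Y01.
have [a a0 Ea] : exists2 a, 0 <= a & 'E_unif[X]%E = a%:E.
  have fX : 'E_unif[X]%E \is a fin_num.
    by rewrite expectation_def; apply: integral_unif_fin_num X01; exact: measurable_funPT.
  exists (fine 'E_unif[X]%E); last by rewrite fineK.
  by rewrite fine_ge0// expectation_def integral_ge0// => t _; rewrite lee_fin;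
    case/andP: (X01 t).
have [b b0 Eb] : exists2 b, 0 <= b & 'E_unif[Y]%E = b%:E.
  have fY : 'E_unif[Y]%E \is a fin_num.
    by rewrite expectation_def; apply: integral_unif_fin_num Y01; exact: measurable_funPT.
  exists (fine 'E_unif[Y]%E); last by rewrite fineK.
  by rewrite fine_ge0// expectation_def integral_ge0// => t _; rewrite lee_fin;
    case/andP: (Y01 t).
have fh := integral_unif_fin_num mh h01.
have EZ : 'E_unif[Z]%E = (M^-1 * fine (\int[unif]_t (h t)%:E)%E)%:E.
  by rewrite expectation_def EFinM fineK// -integral_unifZ// invr_ge0 ltW.
rewrite Ea Eb EZ -!EFinM -EFinD lee_fin in H.
rewrite EX EY Ea Eb -!EFinM /= !powRM// ?(ltW Mf0) ?(ltW Mg0)//.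
rewrite mulrACA -/M mulrC -ler_pdivlMr// [leRHS]mulrC.
apply: le_trans (weighted_am_gm a0 b0 l01) _; apply: H => //.
  by move=> t; rewrite mulr_ge0// invr_ge0 ltW.
move=> s t _ _; rewrite -[Z _]/(M^-1 * _) [leRHS]mulrC ler_pdivlMr//.
apply: le_trans (fgh s t); rewrite /M mulrACA -!powRM ?(ltW Mf0) ?(ltW Mg0)//; last 2 first.
- by case/andP: (Y01 t).
- by case/andP: (X01 s).
have X0s : 0 <= X s by case/andP: (X01 s).
have Y0t : 0 <= Y t by case/andP: (Y01 t).
by apply: ler_pM; rewrite ?powR_ge0//; apply: ge0_ler_powR;
  rewrite ?nnegrE ?mulr_ge0 ?(ltW Mf0) ?(ltW Mg0) ?(ltW l0) ?(ltW k0)//;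
  [case/andP: (f01 s)|case/andP: (g01 t)].
Qed.

End prekopa_leindler_general.

(** * Measurability of vector-valued maps *)

Section coordinatewise_measurability.
Context {R : realType} {m : nat}.

Lemma measurable_coord (i : 'I_m) :
  measurable_fun setT (fun x : Rn R m => (x : 'rV[R]_m) ord0 i).
Proof.
apply: (measurability _ (RGenOInfty.measurableE R)) => _ [_ [a ->] <-].
rewrite setTI; apply: sub_sigma_algebra => /=.
apply: (@open_comp _ _ (fun x : 'rV[R]_m => x ord0 i) `]a, +oo[%classic);
  last exact: interval_open.
by move=> x _; exact: coord_continuous.
Qed.

(** Every open set is a countable union of boxes with rational centre and radius, and the preimage
    of a box is a finite intersection of conditions on single coordinates. *)
Lemma measurable_fun_rV (d : measure_display) (T : measurableType d) (f : T -> Rn R m) :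
  (forall i, measurable_fun setT (fun t => (f t : 'rV[R]_m) ord0 i)) ->
  measurable_fun setT f.
Proof.
move=> mf; apply: (@measurability _ _ T (Rn R m) setT f (@open 'rV[R]_m) erefl) => _ [U oU <-].
rewrite setTI.
pose box (z : {ffun 'I_m -> rat} * rat) : set 'rV[R]_m :=
  [set y | forall i, `|y ord0 i - ratr (z.1 i)| < ratr z.2].
pose B (k : nat) : set 'rV[R]_m :=
  if (unpickle k : option ({ffun 'I_m -> rat} * rat)) is Some z
  then [set y | box z y /\ box z `<=` U] else set0.
have UE : U = \bigcup_k B k.
  apply/seteqP; split => [y Uy|y [k _]]; last first.
    by rewrite /B; case: unpickle => // z [zy zU]; exact: zU.
  have /nbhs_ballP[e /= e0 eU] : nbhs y U by exact: open_nbhs_nbhs.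
  have [r] := @rat_in_itvoo R 0 (e / 2) (divr_gt0 e0 (ltr0Sn _ _)).
  rewrite in_itv/= => /andP[r0 re].
  have [q hq] : exists q : 'I_m -> rat, forall i, `|y ord0 i - ratr (q i)| < ratr r.
    suff /choice[q hq] : forall i, exists q : rat, `|y ord0 i - ratr q| < ratr r by exists q.
    move=> i; have [q] := @rat_in_itvoo R (y ord0 i - ratr r) (y ord0 i + ratr r) ltac:(lra).
    by rewrite in_itv/= => /andP[q1 q2]; exists q; rewrite ltr_norml; apply/andP; split; lra.
  exists (pickle ([ffun i => q i], r)) => //; rewrite /B pickleK; split => /=.
    by move=> i; rewrite ffunE.
  move=> z hz; apply: eU; split => // i j; rewrite ord1 /ball/=.
  have := hq j; have := hz j; rewrite /= ffunE.
  rewrite !ltr_norml => /andP[? ?] /andP[? ?]; apply/andP; split; lra.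
rewrite UE preimage_bigcup; apply: bigcupT_measurable => k; rewrite /B.
case: unpickle => [z|]; last by rewrite preimage_set0.
have [zU|zU] := pselect (box z `<=` U); last first.
  by rewrite (_ : _ @^-1` _ = set0)//; apply/seteqP; split => // t [].
rewrite (_ : _ @^-1` _ = \big[setI/setT]_(i < m) [set t | `|(f t :
  'rV[R]_m) ord0 i - ratr (z.1 i)| < ratr z.2]).
  apply: bigsetI_measurable => i _.
  rewrite (_ : [set t | _] = (fun t => `|(f t :
    'rV[R]_m) ord0 i - ratr (z.1 i)|) @^-1` `]-oo, ratr z.2[%classic); last first.
    by apply/seteqP; split => t /=; rewrite in_itv.
  have mg : measurable_fun setT (fun t => `|(f t : 'rV[R]_m) ord0 i - ratr (z.1 i)|).
    apply: (measurableT_comp (@normr_measurable R setT)) => //.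
    exact: measurable_funB.
  by rewrite -[X in measurable X]setTI; exact: mg.
apply/seteqP; split => [t [h _]|t h].
  by elim/big_ind : _ => // i _; exact: h.
by split => // i; move: h; rewrite (bigD1 i)//= => -[].
Qed.

End coordinatewise_measurability.

(** * The uniform measure on the cube *)

Section add_coordinate.
Context {R : realType} {n : nat}.
Implicit Types (t : R) (x : 'rV[R]_n) (y : 'rV[R]_n.+1).

Definition consR t x : 'rV[R]_n.+1 :=
  \row_i (if unlift ord0 i is Some j then x ord0 j else t).

Definition tailR y : 'rV[R]_n := \row_j y ord0 (lift ord0 j).

Lemma consR0 t x : consR t x ord0 ord0 = t.
Proof. by rewrite mxE unlift_none. Qed.

Lemma consRS t x j : consR t x ord0 (lift ord0 j) = x ord0 j.
Proof. by rewrite mxE liftK. Qed.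

Lemma tailRK t x : tailR (consR t x) = x.
Proof. by apply/rowP => j; rewrite mxE consRS. Qed.

Lemma consRK y : consR (y ord0 ord0) (tailR y) = y.
Proof. by apply/rowP => i; rewrite mxE; case: unliftP => [j ->|->]//; rewrite mxE. Qed.

Lemma consR_comb (l s t : R) x x' :
  l *: consR s x + (1 - l) *: consR t x' =
  consR (l * s + (1 - l) * t) (l *: x + (1 - l) *: x').
Proof. by apply/rowP => i; rewrite !mxE; case: unlift => [j|]//; rewrite !mxE. Qed.

Lemma dot_consR a t x : dot a (consR t x) = a ord0 ord0 * t + dot (tailR a) x.
Proof.
rewrite /dot big_ord_recl consR0; congr (_ + _).
by apply: eq_bigr => j _; rewrite consRS mxE.
Qed.

Lemma tailR_continuous : continuous tailR.
Proof.
move=> y A /nbhs_ballP[e /= e0 eA]; apply/nbhs_ballP; exists e => //= z [_ h].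
by apply: eA; split => // i j; rewrite !mxE ord1; exact: h.
Qed.

Definition consR_pair (z : measurableTypeR R * Rn R n) : Rn R n.+1 := consR z.1 z.2.

Lemma measurable_consR : measurable_fun setT consR_pair.
Proof.
apply: measurable_fun_rV => i; rewrite /consR_pair.
case: (unliftP ord0 i) => [j|] ->.
  under eq_fun do rewrite consRS.
  apply: (measurableT_comp (@measurable_coord R n j)); exact: measurable_snd.
under eq_fun do rewrite consR0.
exact: measurable_fst.
Qed.

HB.instance Definition _ :=
  isMeasurableFun.Build _ _ _ _ consR_pair measurable_consR.

Variable mu : probability (Rn R n) R.

(** The law of a point with first coordinate uniform on the unit interval and an independent tail of
    law [mu]; iterated from dimension 0 it gives the uniform measure on the cube. *)
Definition cylinder : probability (Rn R n.+1) R :=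
  distribution (unif \x mu)%E consR_pair.

Definition slice (A : set 'rV[R]_n.+1) t : set 'rV[R]_n := [set x | A (consR t x)].

Lemma cylinderE (A : set 'rV[R]_n.+1) :
  cylinder A = (\int[unif]_t mu (slice A t))%E.
Proof.
rewrite /cylinder/= /distribution /pushforward /product_measure1.
apply: eq_integral => t _ /=; congr (mu _).
by apply/seteqP; split => x; rewrite /xsection /slice/= inE.
Qed.

Lemma measurable_slice (A : set 'rV[R]_n.+1) t :
  measurable (A : set (Rn R n.+1)) -> measurable (slice A t : set (Rn R n)).
Proof.
move=> mA; have mc : measurable_fun setT (fun x : Rn R n => consR t x : Rn R n.+1).
  apply: measurable_fun_rV => i.
  case: (unliftP ord0 i) => [j|] ->.
    by under eq_fun do rewrite consRS; exact: measurable_coord.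
  by under eq_fun do rewrite consR0; exact: measurable_cst.
by rewrite -[X in measurable X]setTI; exact: mc.
Qed.

Lemma measurable_slice_mass (A : set 'rV[R]_n.+1) :
  measurable (A : set (Rn R n.+1)) ->
  measurable_fun setT (fun t : measurableTypeR R => fine (mu (slice A t))).
Proof.
move=> mA.
have mB : measurable (consR_pair @^-1` A).
  by rewrite -[X in measurable X]setTI; exact: measurable_consR.
apply: (measurableT_comp (fine_measurable measurableT)).
rewrite (_ : (fun t => _) = mu \o xsection (consR_pair @^-1` A)).
  exact: measurable_fun_xsection.
apply/funext => t /=; congr (mu _).
by apply/seteqP; split => x; rewrite /xsection /slice/= inE.
Qed.

Lemma slice_compact (A : set 'rV[R]_n.+1) t : compact A -> compact (slice A t).
Proof.
move=> cA; rewrite (_ : slice A t = tailR @` (A `&` [set y | y ord0 ord0 = t])).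
  apply: continuous_compact; first by apply: continuous_subspaceT; exact: tailR_continuous.
  apply: compact_closedI => //.
  apply: (@closed_comp _ _ (fun y : 'rV[R]_n.+1 => y ord0 ord0) [set r | r = t]);
    last exact: closed_eq.
  by move=> y _; exact: coord_continuous.
apply/seteqP; split => [x Ax|_ [y [Ay yt] <-]].
  by exists (consR t x); [split => //=; rewrite consR0|rewrite tailRK].
by rewrite /slice/= -yt consRK.
Qed.

Lemma cylinder_fineE (A : set 'rV[R]_n.+1) :
  measurable (A : set (Rn R n.+1)) ->
  cylinder A = (\int[unif]_t (fine (mu (slice A t)))%:E)%E.
Proof.
move=> mA; rewrite cylinderE; apply: eq_integral => t _.
by rewrite prob_fineK//; exact: measurable_slice.
Qed.

(** The combination of the slices of [A] at [s] and of [B] at [t] lies in the slice of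
    [mink_comb l A B] at [l * s + (1 - l) * t], so the slice masses satisfy the hypothesis of
    [prekopa_leindler]. *)
Lemma cylinder_log_concave (l : R) :
  (forall (A B : set 'rV[R]_n), compact A -> compact B -> 0 < l < 1 ->
     fine (mu A) `^ l * fine (mu B) `^ (1 - l) <= fine (mu (mink_comb l A B))) ->
  forall (A B : set 'rV[R]_n.+1), compact A -> compact B -> 0 < l < 1 ->
     fine (cylinder A) `^ l * fine (cylinder B) `^ (1 - l) <=
     fine (cylinder (mink_comb l A B)).
Proof.
move=> lcmu A B cA cB l01.
have mA := measurable_compact_Rn cA; have mB := measurable_compact_Rn cB.
have mC := measurable_compact_Rn (mink_comb_compact (l:=l) cA cB).
have h01 (C : set 'rV[R]_n.+1) t : measurable (C : set (Rn R n.+1)) ->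
    0 <= fine (mu (slice C t)) <= 1.
  by move=> mC'; rewrite prob_ge0 prob_le1//; exact: measurable_slice.
rewrite !cylinder_fineE//; apply: prekopa_leindler => //.
- exact: measurable_slice_mass.
- exact: measurable_slice_mass.
- exact: measurable_slice_mass.
- by move=> t; exact: h01.
- by move=> t; exact: h01.
- by move=> t; exact: h01.
move=> s t; have cs := @slice_compact A s cA; have ct := @slice_compact B t cB.
apply: le_trans (lcmu _ _ cs ct l01) _; apply: prob_le.
- by apply: measurable_compact_Rn; exact: mink_comb_compact.
- exact: measurable_slice.
move=> _ [x Ax [x' Bx' <-]]; rewrite /slice/= -consR_comb.
by exists (consR s x) => //; exists (consR t x').
Qed.

(** If the normal has a nonzero tail, every slice is a null hyperplane; otherwise the first
    coordinate is fixed and only one [t] can have a nonempty slice. *)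
Lemma cylinder_hyperplane :
  (forall a b, a != 0 -> mu [set x | dot a x = b] = 0%E) ->
  forall a b, a != 0 -> cylinder [set y | dot a y = b] = 0%E.
Proof.
move=> hmu a b a0; rewrite cylinderE.
have [ta|ta] := eqVneq (tailR a) 0; last first.
  apply: integral0_eq => t _; rewrite -(hmu (tailR a) (b - a ord0 ord0 * t) ta); congr (mu _).
  apply/seteqP; split => x; rewrite /slice/= dot_consR.
    by move=> <-; rewrite addrC addKr.
  by move=> ->; rewrite addrC subrK.
have a00 : a ord0 ord0 != 0.
  apply: contra_neq a0 => a00; rewrite -[a]consRK a00 ta.
  by apply/rowP => i; rewrite !mxE; case: unlift => // j; rewrite mxE.
transitivity (\int[unif]_t (\1_[set b / a ord0 ord0] t)%:E)%E.
  apply: eq_integral => t _; rewrite indicE.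
  have [->|tb] := eqVneq t (b / a ord0 ord0).
    rewrite mem_set//= -(probability_setT mu); congr (mu _).
    apply/seteqP; split => // x _; rewrite /slice/= dot_consR ta mulrC divfK//.
    by rewrite /dot big1 ?addr0// => i _; rewrite mxE mul0r.
  rewrite memNset//=; last exact/eqP.
  transitivity (mu set0); last by rewrite measure0.
  congr (mu _); apply/seteqP; split => // x; rewrite /slice/= dot_consR ta.
  rewrite /dot big1 ?addr0 => [h|i _]; last by rewrite mxE mul0r.
  by move/eqP: tb; apply; rewrite -h mulrC mulKf.
rewrite integral_indic//= setIT unifE//.
apply/eqP; rewrite eq_le measure_ge0 andbT -(lebesgue_measure_set1 (b / a ord0 ord0)).
by apply: le_measure; rewrite ?inE//; exact: measurableI.
Qed.

End add_coordinate.

(** The induction carries mass 0 for hyperplanes instead of mass less than 1. It starts from the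
    Dirac mass in dimension 0, where no normal is nonzero. *)
Lemma exists_log_concave (R : realType) (n : nat) :
  exists mu : probability (Rn R n) R, log_concave mu.
Proof.
suff [mu [lcmu hmu]] : exists mu : probability (Rn R n) R,
    (forall l (A B : set 'rV[R]_n), compact A -> compact B -> 0 < l < 1 ->
     fine (mu A) `^ l * fine (mu B) `^ (1 - l) <= fine (mu (mink_comb l A B))) /\
    (forall a b, a != 0 -> mu [set x | dot a x = b] = 0%E).
  exists mu; split; first by move=> A B l cA cB l01; exact: lcmu.
  by move=> _ [a [b [a0 ->]]]; rewrite [X in (X < _)%E]hmu.
elim: n => [|n [mu [lcmu hmu]]]; last first.
  exists (cylinder mu); split; last exact: cylinder_hyperplane.
  by move=> l; apply: cylinder_log_concave; exact: lcmu.
pose nu : probability (Rn R 0) R := distribution unif (cst (0 : Rn R 0)).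
have nuE (A : set 'rV[R]_0) : nu A = ((0 : 'rV[R]_0) \in A)%:R%:E.
  rewrite /nu/= /distribution /pushforward preimage_cst.
  by case: ifPn => _; rewrite ?probability_setT// measure0.
exists nu; split.
  move=> l A B cA cB /andP[l0 l1]; rewrite !nuE/=.
  have [A0|A0] := boolP (_ \in A); last by rewrite powR0 ?mul0r// gt_eqF.
  have [B0|B0] := boolP (_ \in B); last by rewrite [X in _ * X]powR0 ?mulr0// gt_eqF// subr_gt0.
  rewrite mem_set; first by rewrite !powR1 mulr1.
  exists 0; first by rewrite inE in A0.
  by exists 0; [rewrite inE in B0|rewrite !scaler0 addr0].
by move=> a b; rewrite (_ : a = 0) ?eqxx//; apply/rowP => -[].
Qed.

(** * Convergence of the infimum *)

Lemma expected_hull_mass_le1 (R : realType) (n N : nat) (mu : probability (Rn R n) R) :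
  (expected_hull_mass mu N <= 1)%E.
Proof.
apply: iter_expect_le1 => x //; apply: probability_le1.
by apply: measurable_compact_Rn; exact: hullN_compact.
Qed.

Theorem theorem5p8 (R : realType) :
  exists C : R, 0 < C /\
    forall u : nat -> R, (forall n, 0 < u n) ->
      u n @[n --> \oo] --> +oo ->
      inf_quantity C u n @[n --> \oo] --> 1%E.
Proof.
exists 22; split => // u _ uoo.
(* [harmonic n] is [1 / (n + 1)], and [32 / (n + 1) >= 16 / n], so [f n] is below the bound
   [1 - 16 / n]. *)
pose f (n : nat) : \bar R := (1 - 32 * harmonic n)%:E.
apply: (@squeeze_cvge _ _ _ _ f _ (cst 1%E)); last 2 first.
- apply: cvg_EFin; first by near=> n.
  rewrite -[X in _ --> X]subr0 -[X in _ - X](mulr0 32).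
  by apply: cvgB; [exact: cvg_cst|apply: cvgMr; exact: cvg_harmonic].
- exact: cvg_cst.
near=> n.
have n16 : (16 <= n)%N by near: n; exact: nbhs_infty_ge.
have un : 1 <= u n by near: n; move/cvgryPge : uoo; exact.
apply/andP; split.
  apply: le_ereal_inf_tmp => _ [mu lc <-]; apply: le_ereal_inf_tmp => _ [N hN <-].
  apply: le_trans (log_concave_lower_bound n16 un lc hN); rewrite lee_fin lerD2l lerN2.
  have x16 : 16 <= n%:R :> R by rewrite ler_nat.
  rewrite ler_pdivrMr; last lra.
  rewrite /harmonic mulrAC ler_pdivlMr// -natr1; lra.
(* One measure and one admissible [N] bound both infima by 1. *)
have [mu lc] := exists_log_concave R n.
apply: ge_ereal_inf; eexists; first by exists mu.
set E := expR _.
apply: ge_ereal_inf; eexists; first by exists (Num.truncn E).+1 => //=; exact/ltW/truncnS_gt.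
exact: expected_hull_mass_le1.
Unshelve. all: by end_near. Qed.
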